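(* Let $f\in\mathcal{SH}_L(\mathbb{D})$ be given by $f(s)=\sum_{\ell=1}^{+\infty}s^{n_\ell}a_\ell$ with $a_\ell\in\mathbb{H}$ and positive integers $n_\ell$ such that, for some real $\alpha$, $n_{\ell+1}/n_\ell\ge\alpha>1$ for all $\ell\in\mathbb{N}$. Then the following statements are equivalent: (i) $f\in\mathrm{BMOSH}(\mathbb{D})$; (ii) $f\in\mathrm{VMOSH}(\mathbb{D})$; (iii) $f\in\mathcal{H}^2(\mathbb{D})$.
   Context: Let $\mathbb{H}$ be the quaternions, $\mathbb{S}=\{x\in\mathbb{H}:\mathrm{Re}(x)=0,|x|=1\}$, $\mathbb{D}$ the open unit ball of $\mathbb{H}$. Every $x\in\mathbb{H}$ is written $x=x_0+i_xx_1$ with $x_0=\mathrm{Re}(x)$, $x_1=|\mathrm{Im}(x)|\ge 0$, $i_x\in\mathbb{S}$. A real differentiable $f:\mathbb{D}\to\mathbb{H}$ is (left) slice hyperholomorphic, $f\in\mathcal{SH}_L(\mathbb{D})$, if $f(x)=\alpha(x_0,x_1)+i_x\beta(x_0,x_1)$ for all $x\in\mathbb{D}$, where the $\mathbb{H}$-valued functions $\alpha,\beta$ satisfy $\alpha(x_0,-x_1)=\alpha(x_0,x_1)$, $\beta(x_0,-x_1)=-\beta(x_0,x_1)$, $\partial_{x_0}\alpha=\partial_{x_1}\beta$, $\partial_{x_0}\beta=-\partial_{x_1}\alpha$. Power series $\sum_n x^na_n$, $a_n\in\mathbb{H}$, converging on $\mathbb{D}$ are slice hyperholomorphic. $\mathcal{H}^2(\mathbb{D})$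 is the set of $f\in\mathcal{SH}_L(\mathbb{D})$ with $\sup_{i\in\mathbb{S}}\lim_{r\nearrow1}\frac1{2\pi}\int_0^{2\pi}|f(re^{i\theta})|^2\,d\theta<\infty$; boundary values $f(e^{i\theta})$ are radial limits (existing for almost every $\theta$). For $f\in\mathcal{H}^2(\mathbb{D})$, $i\in\mathbb{S}$ and a bounded open interval $I\subset\mathbb{R}$ with length $|I|\le2\pi$, let $f_{I,i}=\frac1{|I|}\int_If(e^{i\theta})\,d\theta$. $\mathrm{BMOSH}(\mathbb{D})$ is the set of $f\in\mathcal{H}^2(\mathbb{D})$ with $\sup_{i\in\mathbb{S}}\sup_{|I|\le2\pi}\frac1{|I|}\int_I|f(e^{i\theta})-f_{I,i}|^2\,d\theta<\infty$. $\mathrm{VMOSH}(\mathbb{D})$ is the set of $f\in\mathrm{BMOSH}(\mathbb{D})$ such that $\lim_{|I|\to0}\frac1{|I|}\int_I|f(e^{i\theta})-f_{I,i}|^2\,d\theta=0$ (uniformly over intervals $I\subset\mathbb{R}$ of length $|I|$) for all $i\in\mathbb{S}$. *)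

(* Defs.v *)
From HB Require Import structures.
From mathcomp Require Import all_boot all_order all_algebra ring lra.
From mathcomp Require Import all_classical all_reals all_analysis.
Import Order.TTheory GRing.Theory Num.Theory.
Import numFieldNormedType.Exports.

Set Implicit Arguments.
Unset Strict Implicit.
Unset Printing Implicit Defensive.

Local Open Scope classical_set_scope.
Local Open Scope ring_scope.

(* Quat a b c d stands for a + b i + c j + d k. *)

Record quat (R : Type) := Quat { qre : R; qi : R; qj : R; qk : R }.

Section QuatChoice.
Variable R : Type.

Definition quat_to_prod (x : quat R) := (qre x, qi x, qj x, qk x).
Definition quat_of_prod (p : R * R * R * R) :=
  let: (a, b, c, d) := p in Quat a b c d.

Lemma quat_to_prodK : cancel quat_to_prod quat_of_prod.
Proof. by case. Qed.

End QuatChoice.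

HB.instance Definition _ (R : choiceType) :=
  Choice.copy (quat R) (can_type (@quat_to_prodK R)).

Section QuatRing.
Variable R : comNzRingType.
Implicit Types x y z : quat R.

Definition addq x y :=
  Quat (qre x + qre y) (qi x + qi y) (qj x + qj y) (qk x + qk y).
Definition oppq x := Quat (- qre x) (- qi x) (- qj x) (- qk x).

Definition mulq x y :=
  let: Quat a b c d := x in
  let: Quat a' b' c' d' := y in
  Quat (a * a' - b * b' - c * c' - d * d')
       (a * b' + b * a' + c * d' - d * c')
       (a * c' - b * d' + c * a' + d * b')
       (a * d' + b * c' - c * b' + d * a').

Definition scaleq (r : R) x := Quat (r * qre x) (r * qi x) (r * qj x) (r * qk x).

Lemma addqA : associative addq.
Proof. by case=> ? ? ? ? [? ? ? ?] [? ? ? ?]; rewrite /addq /= !addrA. Qed.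

Lemma addqC : commutative addq.
Proof. by case=> a b c d [? ? ? ?]; congr Quat; exact: addrC. Qed.

Lemma add0q : left_id (Quat 0 0 0 0) addq.
Proof. by case=> ? ? ? ?; rewrite /addq /= !add0r. Qed.

Lemma addNq : left_inverse (Quat 0 0 0 0) oppq addq.
Proof. by case=> ? ? ? ?; rewrite /addq /= !addNr. Qed.

HB.instance Definition _ :=
  GRing.isZmodule.Build (quat R) addqA addqC add0q addNq.

Lemma mulqA : associative mulq.
Proof. by case=> ? ? ? ? [? ? ? ?] [? ? ? ?]; congr Quat; ring. Qed.

Lemma mul1q : left_id (Quat 1 0 0 0) mulq.
Proof. by case=> ? ? ? ?; congr Quat; ring. Qed.

Lemma mulq1 : right_id (Quat 1 0 0 0) mulq.
Proof. by case=> ? ? ? ?; congr Quat; ring. Qed.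

Lemma mulqDl : left_distributive mulq addq.
Proof. by case=> ? ? ? ? [? ? ? ?] [? ? ? ?]; congr Quat => /=; ring. Qed.

Lemma mulqDr : right_distributive mulq addq.
Proof. by case=> ? ? ? ? [? ? ? ?] [? ? ? ?]; congr Quat => /=; ring. Qed.

Lemma oneq_neq0 : Quat 1 0 0 0 != 0 :> quat R.
Proof. by apply/eqP => -[/eqP]; rewrite oner_eq0. Qed.

HB.instance Definition _ :=
  GRing.Zmodule_isNzRing.Build (quat R) mulqA mul1q mulq1 mulqDl mulqDr oneq_neq0.

Lemma scaleqA (a b : R) x : scaleq a (scaleq b x) = scaleq (a * b) x.
Proof. by rewrite /scaleq /= !mulrA. Qed.

Lemma scale1q : left_id 1 scaleq.
Proof. by case=> ? ? ? ?; rewrite /scaleq /= !mul1r. Qed.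

Lemma scaleqDr : right_distributive scaleq +%R.
Proof. by move=> ? [? ? ? ?] [? ? ? ?]; congr Quat => /=; ring. Qed.

Lemma scaleqDl x : {morph scaleq^~ x : a b / a + b}.
Proof. by move=> ? ?; case: x => ? ? ? ?; congr Quat => /=; ring. Qed.

HB.instance Definition _ := GRing.Zmodule_isLmodule.Build R (quat R)
  scaleqA scale1q scaleqDr scaleqDl.

Lemma scaleqAl (a : R) x y : a *: (x * y) = a *: x * y.
Proof. by case: x y => ? ? ? ? [? ? ? ?]; congr Quat => /=; ring. Qed.

HB.instance Definition _ :=
  GRing.Lmodule_isLalgebra.Build R (quat R) scaleqAl.

Lemma scaleqAr (a : R) x y : a *: (x * y) = x * (a *: y).
Proof. by case: x y => ? ? ? ? [? ? ? ?]; congr Quat => /=; ring. Qed.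

HB.instance Definition _ := GRing.Lalgebra_isAlgebra.Build R (quat R) scaleqAr.

End QuatRing.

Section QuatNorm.
Variable R : realType.
Implicit Types x y : quat R.

Definition normq x := Num.sqrt (qre x ^+ 2 + qi x ^+ 2 + qj x ^+ 2 + qk x ^+ 2).

Lemma normqZ (r : R) x : normq (r *: x) = `|r| * normq x.
Proof.
by rewrite /normq /= !exprMn -!mulrDr sqrtrM ?sqr_ge0// sqrtr_sqr.
Qed.

Lemma normq_eq0 x : normq x = 0 -> x = 0.
Proof.
case: x => a b c d /eqP; rewrite /normq /= sqrtr_eq0 => h.
have [a0 b0 c0 d0] : [/\ a ^+ 2 = 0, b ^+ 2 = 0, c ^+ 2 = 0 & d ^+ 2 = 0].
  by move: (sqr_ge0 a) (sqr_ge0 b) (sqr_ge0 c) (sqr_ge0 d) => *; split; lra.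
by congr Quat; apply/eqP; rewrite -sqrf_eq0; apply/eqP.
Qed.

Lemma ler_normqD x y : normq (x + y) <= normq x + normq y.
Proof.
case: x y => a b c d [a' b' c' d']; rewrite /normq /=.
set X := a ^+ 2 + _ + _ + _; set Y := a' ^+ 2 + _ + _ + _.
have X0 : 0 <= X by rewrite !addr_ge0 ?sqr_ge0.
have Y0 : 0 <= Y by rewrite !addr_ge0 ?sqr_ge0.
rewrite -[leRHS]ger0_norm ?addr_ge0 ?sqrtr_ge0// -sqrtr_sqr ler_wsqrtr//.
rewrite [leRHS]sqrrD !sqr_sqrtr// -sqrtrM//.
suff : a * a' + b * b' + c * c' + d * d' <= Num.sqrt (X * Y).
  by rewrite /X /Y => h; lra.
apply: le_trans (ler_norm _) _.
rewrite -sqrtr_sqr ler_wsqrtr// -subr_ge0 /X /Y.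
rewrite [leRHS](_ : _ = (a * b' - b * a') ^+ 2 + (a * c' - c * a') ^+ 2
  + (a * d' - d * a') ^+ 2 + (b * c' - c * b') ^+ 2 + (b * d' - d * b') ^+ 2
  + (c * d' - d * c') ^+ 2); last by ring.
by rewrite !addr_ge0 ?sqr_ge0.
Qed.

HB.instance Definition _ :=
  Lmodule_isNormed.Build R (quat R) ler_normqD normqZ normq_eq0.

End QuatNorm.

Section SliceHyperholomorphic.
Variable R : realType.
Local Notation H := (quat R).
Implicit Types (f : H -> H) (i x : H).

Definition imq x : H := x - (qre x)%:A.

Definition imag_sphere : set H := [set i | qre i = 0 /\ `|i| = 1].

Definition unit_ball : set H := [set x | `|x| < 1].

(* Every i with x = x0 + x1 i is allowed as i_x: for nonreal x it is unique, for
   real x every element of the sphere qualifies. *)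
Definition slice_function f (alpha beta : R -> R -> H) :=
  forall x i, unit_ball x -> imag_sphere i ->
    x = (qre x)%:A + `|imq x| *: i ->
    f x = alpha (qre x) `|imq x| + i * beta (qre x) `|imq x|.

Definition even_odd (alpha beta : R -> R -> H) :=
  forall x0 x1 : R, x0 ^+ 2 + x1 ^+ 2 < 1 ->
    alpha x0 (- x1) = alpha x0 x1 /\ beta x0 (- x1) = - beta x0 x1.

(* derive1 is a total function, hence the explicit derivability conditions; they
   follow from the real differentiability of f. *)
Definition cauchy_riemann (alpha beta : R -> R -> H) :=
  forall x0 x1 : R, x0 ^+ 2 + x1 ^+ 2 < 1 ->
    [/\ derivable (alpha^~ x1) x0 1, derivable (alpha x0) x1 1,
        derivable (beta^~ x1) x0 1 & derivable (beta x0) x1 1] /\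
    derive1 (alpha^~ x1) x0 = derive1 (beta x0) x1 /\
    derive1 (beta^~ x1) x0 = - derive1 (alpha x0) x1.

(* f is total, but only its values on the unit ball matter, here and below. *)
Definition slice_hyperholomorphic f :=
  (forall x, unit_ball x -> differentiable f x) /\
  exists alpha beta : R -> R -> H,
    [/\ slice_function f alpha beta, even_odd alpha beta
      & cauchy_riemann alpha beta].

Definition expq i (t : R) : H := (cos t)%:A + sin t *: i.

Local Notation mu := (@lebesgue_measure R).

Definition square_mean f i (r : R) : \bar R :=
  (((2 * pi)^-1)%:E *
   \int[mu]_(t in `[0%R, (2 * pi)%R]) (`|f (r *: expq i t)| ^+ 2)%:E)%E.

(* The square means of a slice hyperholomorphic function increase with r, so the
   (total) lim is a genuine limit in \bar R. *)
Definition H2 : set (H -> H) := [set f | slice_hyperholomorphic f /\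
  (ereal_sup [set lim (square_mean f i r @[r --> (1%R : R)^'-])
             | i in imag_sphere] < +oo)%E].

(* Equal to 0, the default point of H, where the radial limit does not exist. *)
Definition boundary_value f i (t : R) : H :=
  lim (f (r *: expq i t) @[r --> (1 : R)^'-]).

Definition integralq (D : set R) (g : R -> H) : H :=
  Quat (\int[mu]_(t in D) qre (g t)) (\int[mu]_(t in D) qi (g t))
       (\int[mu]_(t in D) qj (g t)) (\int[mu]_(t in D) qk (g t)).

Definition boundary_mean f i (a b : R) : H :=
  (b - a)^-1 *: integralq `]a, b[ (boundary_value f i).

Definition mean_oscillation f i (a b : R) : \bar R :=
  (((b - a)^-1)%:E *
   \int[mu]_(t in `]a, b[)
     (`|boundary_value f i t - boundary_mean f i a b| ^+ 2)%:E)%E.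

Definition BMOSH : set (H -> H) := [set f | H2 f /\
  (ereal_sup [set m | (exists i (a b : R),
      [/\ imag_sphere i, a < b, b - a <= 2 * pi
        & m = mean_oscillation f i a b])%R] < +oo)%E].

(* The supremum over all intervals of length t makes the limit uniform. *)
Definition VMOSH : set (H -> H) := [set f | BMOSH f /\
  forall i, imag_sphere i ->
    ereal_sup [set mean_oscillation f i a (a + t) | a in [set: R]]
      @[t --> (0 : R)^'+] --> 0%E].

End SliceHyperholomorphic.

(* Main.v *)
(* By definition VMOSH is contained in BMOSH and BMOSH in H2, so the point is that
   H2 implies VMOSH.  Parseval on circles shows that the square means of f increase
   with the radius, whence sum |a_l|^2 is finite.

   A subsequence S_k of the partial sums whose tails decay geometrically in L^2
   then converges almost everywhere to a locally integrable F.  At a Lebesgue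
   point t of F, the average of F over [t - h, t + h] and the value of f at radius
   1 - h differ by at most sum |a_l| min(n_l h, 1/(n_l h)), up to a constant; by
   lacunarity this tends to 0 with h, hence F is the radial limit of f.

   For an interval of length h let m be the first index with n_m h >= 1.  Modes
   below m oscillate on it by at most sum |a_l| min(n_l h, 1/(n_l h)), and modes
   from m on are almost orthogonal on it, so that their mean square is at most a
   constant times the tail of sum |a_l|^2 from m.  Both bounds are uniform in the
   interval and in the slice, bounded, and tend to 0 with h. *)
Require Import Defs.
From HB Require Import structures.
From mathcomp Require Import all_boot all_order all_algebra ring lra.
From mathcomp Require Import all_classical all_reals all_analysis measurable_realfun.
Import Order.TTheory GRing.Theory Num.Theory.
Import numFieldNormedType.Exports.

Set Implicit Arguments.
Unset Strict Implicit.
Unset Printing Implicit Defensive.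

Local Open Scope classical_set_scope.
Local Open Scope ring_scope.

(** * Lacunary sequences *)

(** The boundary value is a total [lim], with a default value where no radial limit exists, and it
    is not known to be measurable. Every integral of it is therefore moved, by equality almost
    everywhere, to a measurable limit [F] of partial sums. Taking tails of the squared coefficients
    below [4^-k] makes the successive L^2 differences of size [2^-k], hence summable in L^1 on
    bounded intervals: this gives convergence almost everywhere and a dominating function at once.
    From then on [F] enters the radial limit argument only through its integrals over intervals.

    The coefficients do not commute with the imaginary unit [i], so complex exponentials are
    replaced by the real inner product on quaternions: the product of two modes is a cosine and a
    sine of the same frequency difference, with two different real coefficients.

    The half-length [h] of an average is matched with the radius [1 - h] because both operations
    begin to damp a mode of frequency [n] when [n h] is about 1. All lacunarity constants come from
    [A / (A - 1)]. *)

Section Lacunary.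
Variables (R : realType) (nu : nat -> R) (A : R).
Hypothesis A_gt1 : 1 < A.
Hypothesis nu_gt0 : forall l, 0 < nu l.
Hypothesis nu_lac : forall l, A * nu l <= nu l.+1.

Let A_gt0 : 0 < A. Proof. exact: lt_trans A_gt1. Qed.
Let A1_gt0 : 0 < A - 1. Proof. by rewrite subr_gt0. Qed.

(** The sum of the geometric series of ratio [1 / A]. The inductions below rest on the fixed-point
    identity [C / A + 1 = C]. *)
Definition lac_const := A / (A - 1).

Lemma lac_const_gt0 : 0 < lac_const.
Proof. exact: divr_gt0. Qed.

Let lac_constE : lac_const / A + 1 = lac_const.
Proof. by rewrite /lac_const; field; rewrite !gt_eqF. Qed.

Lemma lac_incr l k : (l <= k)%N -> nu l <= nu k.
Proof.
move=> /subnK <-; elim: (k - l)%N => [|d IH]; first by rewrite add0n.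
rewrite (le_trans IH)// addSn (le_trans _ (nu_lac _))// ler_peMl ?ltW//.
Qed.

(** Bernoulli's inequality for [A ^ d]. Linear growth suffices both to make [nu] unbounded and to
    bound the number of indices between [m] and [k] by a multiple of [nu k / nu m]. *)
Lemma lac_bernoulli m d : (1 + d%:R * (A - 1)) * nu m <= nu (m + d)%N.
Proof.
elim: d => [|d IH]; first by rewrite mul0r addr0 mul1r addn0.
rewrite addnS (le_trans _ (nu_lac _))// (le_trans _ (ler_wpM2l (ltW A_gt0) IH))//.
rewrite mulrA ler_wpM2r ?(ltW (nu_gt0 _))// -natr1.
have d0 : 0 <= d%:R :> R by [].
have := mulr_ge0 d0 (sqr_ge0 (A - 1)); nra.
Qed.

Lemma lac_gap l k : (k < l)%N -> (1 - A^-1) * nu l <= nu l - nu k.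
Proof.
move=> kl; rewrite mulrBl mul1r lerB//.
rewrite ler_pdivlMl//; case: l kl => // l kl.
by rewrite (le_trans _ (nu_lac _))// ler_wpM2l ?(ltW A_gt0)// lac_incr.
Qed.

Lemma lac_sum_inv m N : \sum_(m <= l < N) (nu l)^-1 <= lac_const / nu m.
Proof.
have [mN|Nm] := leqP m N; last first.
  by rewrite big_geq 1?ltnW// divr_ge0// ltW// lac_const_gt0.
move: mN => /subnK <-; move: (N - m)%N => {N} d.
elim: d m => [|d IH] m.
  by rewrite add0n big_geq// divr_ge0// ltW// lac_const_gt0.
rewrite addSn big_ltn ?ltnS ?leq_addl// -addnS.
apply: (@le_trans _ _ ((nu m)^-1 + lac_const / nu m.+1)).
  by rewrite lerD2l IH.
rewrite -[in leRHS]lac_constE mulrDl mul1r addrC lerD2r -mulrA -invfM.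
rewrite ler_wpM2l ?(ltW lac_const_gt0)// lef_pV2 ?nu_lac// posrE//.
exact: mulr_gt0.
Qed.

Lemma lac_sum N : \sum_(0 <= l < N.+1) nu l <= lac_const * nu N.
Proof.
elim: N => [|N IH].
  rewrite big_nat1 ler_peMl ?(ltW (nu_gt0 _))// /lac_const ler_pdivlMr//.
  by rewrite mul1r lerBlDr lerDl.
rewrite big_nat_recr//= (le_trans (lerD IH (lexx _)))//.
rewrite -[in leRHS]lac_constE mulrDl mul1r lerD2r -mulrA.
by rewrite ler_wpM2l ?(ltW lac_const_gt0)// ler_pdivlMl.
Qed.

Lemma lac_threshold (h : R) : 0 < h ->
  exists m, (forall l, (l < m)%N -> nu l * h < 1) /\ 1 <= nu m * h.
Proof.
move=> h0; have ex : exists m, 1 <= nu m * h.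
  (* By [lac_bernoulli] from index 0, [nu d * h] is at least [d * (h * (A - 1) * nu 0)], which
     reaches 1 once [d >= x]. *)
  pose x := (h * (A - 1) * nu 0%N)^-1.
  have x0 : 0 < h * (A - 1) * nu 0%N by rewrite !mulr_gt0.
  exists (Num.bound x); rewrite -[Num.bound x]add0n.
  have := lac_bernoulli 0 (Num.bound x).
  have x1 : 1 <= (Num.bound x)%:R * (h * (A - 1) * nu 0%N).
    rewrite -ler_pdivrMr// div1r ltW//.
    by apply: archi_boundP; rewrite invr_ge0 ltW.
  move=> /(ler_wpM2r (ltW h0)); apply: le_trans.
  apply: (le_trans x1); have := mulr_ge0 (ltW h0) (ltW (nu_gt0 0)); lra.
exists (ex_minn ex); case: ex_minnP => m m1 min; split=> // l lm.
by rewrite ltNge; apply/negP => /min; rewrite leqNgt lm.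
Qed.

(** Around the threshold [m] the terms decay geometrically in both directions: [lac_sum] bounds the
    part below by [C * nu (m - 1) * h], [lac_sum_inv] the part above by [C / (nu m * h)]. *)
Lemma lac_sum_min (h : R) N : 0 < h ->
  \sum_(0 <= l < N) Num.min (nu l * h) (nu l * h)^-1 <= 2 * lac_const.
Proof.
move=> h0; have [m [mlt mge]] := lac_threshold h0.
have t0 l : 0 <= Num.min (nu l * h) (nu l * h)^-1.
  by rewrite le_min invr_ge0 andbb mulr_ge0 ?ltW.
(* Extending the sum to [maxn m N] allows the cut at [m] whatever the order of [m] and [N]. *)
apply: (@le_trans _ _
    (\sum_(0 <= l < maxn m N) Num.min (nu l * h) (nu l * h)^-1)).
  by rewrite [leRHS](@big_cat_nat _ _ _ N) ?leq_maxr//= lerDl sumr_ge0.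
rewrite (@big_cat_nat _ _ _ m) ?leq_maxl//=.
rewrite mulr_natl mulr2n lerD//.
  case: m mlt {mge} => [|m] mlt.
    by rewrite big_geq// ltW// lac_const_gt0.
  apply: (@le_trans _ _ (\sum_(0 <= l < m.+1) nu l * h)).
    by apply: ler_sum => l _; rewrite ge_min lexx.
  rewrite -mulr_suml (le_trans (ler_wpM2r (ltW h0) (lac_sum m)))//.
  by rewrite -mulrA ler_piMr ?(ltW lac_const_gt0)// ltW// mlt.
apply: (@le_trans _ _ (\sum_(m <= l < maxn m N) (nu l)^-1 * h^-1)).
  by apply: ler_sum => l _; rewrite -invfM ge_min lexx orbT.
have hV0 : 0 <= h^-1 by rewrite invr_ge0 ltW.
rewrite -mulr_suml (le_trans (ler_wpM2r hV0 (lac_sum_inv m _)))//.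
rewrite -mulrA -invfM ler_piMr ?(ltW lac_const_gt0)//.
by rewrite invf_le1// (lt_le_trans ltr01).
Qed.

Lemma lac_sum_min_cvg0 (x : nat -> R) (e : R) :
  (forall l, 0 <= x l) -> x l @[l --> \oo] --> 0 -> 0 < e ->
  exists2 d : R, 0 < d & forall h N, 0 < h < d ->
    \sum_(0 <= l < N) x l * Num.min (nu l * h) (nu l * h)^-1 <= e.
Proof.
move=> x0 /cvgrPdist_le xc e0.
have C0 := lac_const_gt0.
have e20 : 0 < e / 2 / (2 * lac_const) by rewrite !divr_gt0// mulr_gt0.
have /(_ _ e20)[L _ xL] := xc.
pose K := \sum_(0 <= l < L) x l * nu l.
have K0 : 0 <= K by rewrite sumr_ge0// => l _; rewrite mulr_ge0 ?x0// ltW.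
exists (e / 2 / (K + 1)); first by rewrite !divr_gt0// ltr_wpDl// ltr01.
move=> h N /andP[h0]; rewrite ltr_pdivlMr ?ltr_wpDl// => hK.
have t0 l : 0 <= Num.min (nu l * h) (nu l * h)^-1.
  by rewrite le_min invr_ge0 andbb mulr_ge0 ?ltW.
(* The first [L] terms contribute at most [h * K], which is below [e / 2] by the choice of [d]; the
   others have [x l <= e / (4 C)], and [lac_sum_min] bounds them by [e / 2]. *)
have -> : e = h * K + (e - h * K) by ring.
apply: (@le_trans _ _ (\sum_(0 <= l < N) (x l * nu l * h *+ (l < L)%N +
   e / 2 / (2 * lac_const) * Num.min (nu l * h) (nu l * h)^-1))).
  apply: ler_sum => l _; case: ltnP => lL.
    rewrite mulr1n; apply: ler_wpDr; first exact: mulr_ge0 (ltW e20) (t0 l).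
    by rewrite -mulrA ler_wpM2l ?x0// ge_min lexx.
  rewrite mulr0n add0r ler_wpM2r ?t0//.
  by have := xL l lL; rewrite /= sub0r normrN ger0_norm.
rewrite big_split/= -mulr_sumr lerD//.
  rewrite mulrC /K mulr_suml.
  apply: (@le_trans _ _ (\sum_(0 <= l < maxn L N) x l * nu l * h *+ (l < L)%N)).
    rewrite [leRHS](@big_cat_nat _ _ _ N) ?leq_maxr//= lerDl sumr_ge0// => l _.
    by rewrite mulrn_wge0// !mulr_ge0 ?x0 ?(ltW h0) ?(ltW (nu_gt0 _)).
  rewrite (@big_cat_nat _ _ _ L) ?leq_maxl//=.
  rewrite [X in _ + X]big_nat [X in _ + X]big1 ?addr0.
    by apply: ler_sum_nat => l /andP[_ ->].
  by move=> l /andP[Ll _]; rewrite ltnNge Ll.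
apply: (le_trans (ler_wpM2l (ltW e20) (lac_sum_min N h0))).
rewrite mulfVK; last by rewrite mulf_neq0 ?gt_eqF.
have : h * K <= h * (K + 1) by rewrite ler_wpM2l ?(ltW h0)// lerDl.
by move=> /le_lt_trans/(_ hK); lra.
Qed.

End Lacunary.

(** * Integrals of trigonometric functions *)

Section TrigIntegral.
Variable R : realType.
Local Notation mu := (@lebesgue_measure R).
Implicit Types (g F : R -> R) (a b m : R).

Lemma continuous_integrable_oo g a b :
  continuous g -> mu.-integrable `]a, b[ (EFin \o g).
Proof.
move=> cg; apply: (@integrableS _ _ _ mu `[a, b]) => //.
  exact: subset_itv_oo_cc.
apply: continuous_compact_integrable; first exact: segment_compact.
exact: continuous_subspaceT.
Qed.

Lemma Rintegral_oo_FTC F g a b : a < b -> continuous g ->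
  (forall x : R, is_derive x (1 : R) F (g x)) ->
  \int[mu]_(t in `]a, b[) g t = F b - F a.
Proof.
move=> ab cg dF.
have cF : continuous F.
  by move=> x; apply/differentiable_continuous/derivable1_diffP; case: (dF x).
rewrite Rintegral_itv_obnd_cbnd; last exact: continuous_integrable_oo.
rewrite Rintegral_itv_bndo_bndc; last first.
  apply: (@integrableS _ _ _ mu `[a, b]) => //.
    by apply: subset_itvl; rewrite bnd_simp.
  apply: continuous_compact_integrable; first exact: segment_compact.
  exact: continuous_subspaceT.
rewrite /Rintegral (@continuous_FTC2 _ _ F)//.
- exact: continuous_subspaceT.
- split; first by move=> x _; case: (dF x).
    exact: cvg_at_right_filter (cF _).
  exact: cvg_at_left_filter (cF _).
- by move=> x _; rewrite derive1E; case: (dF x).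
Qed.

Lemma Rintegral_oo_cst a b (c : R) : a <= b ->
  \int[mu]_(t in `]a, b[) c = c * (b - a).
Proof.
move=> ab; rewrite Rintegral_cst//= lebesgue_measure_itv/= lte_fin; congr (c * _).
by case: ltP => //= ba; apply/eqP; rewrite eq_sym subr_eq0 eq_le ab ba.
Qed.

Lemma continuous_cosM m : continuous (fun t : R => cos (m * t)).
Proof.
move=> x; apply: continuous_comp; last exact: continuous_cos.
exact: mulrl_continuous.
Qed.

Lemma continuous_sinM m : continuous (fun t : R => sin (m * t)).
Proof.
move=> x; apply: continuous_comp; last exact: continuous_sin.
exact: mulrl_continuous.
Qed.

Lemma Rintegral_cos a b m : a < b -> m != 0 ->
  \int[mu]_(t in `]a, b[) cos (m * t) = m^-1 * (sin (m * b) - sin (m * a)).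
Proof.
move=> ab m0.
have dF (x : R) : is_derive x (1 : R) (fun t => m^-1 * sin (m * t)) (cos (m * x)).
  apply: is_derive_eq.
  by rewrite /GRing.scale/=; field; exact: m0.
by rewrite (Rintegral_oo_FTC ab (@continuous_cosM m) dF) mulrBr.
Qed.

Lemma Rintegral_sin a b m : a < b -> m != 0 ->
  \int[mu]_(t in `]a, b[) sin (m * t) = m^-1 * (cos (m * a) - cos (m * b)).
Proof.
move=> ab m0.
have dF (x : R) : is_derive x (1 : R) (fun t => - m^-1 * cos (m * t)) (sin (m * x)).
  apply: is_derive_eq.
  by rewrite /GRing.scale/=; field; exact: m0.
by rewrite (Rintegral_oo_FTC ab (@continuous_sinM m) dF); ring.
Qed.

Let norm_cosB (x y : R) : `|cos x - cos y| <= 2.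
Proof. by move: (cos_max x) (cos_max y); rewrite !ler_norml; lra. Qed.

Let norm_sinB (x y : R) : `|sin x - sin y| <= 2.
Proof. by move: (sin_max x) (sin_max y); rewrite !ler_norml; lra. Qed.

Lemma norm_Rintegral_cos a b m : a < b -> m != 0 ->
  `|\int[mu]_(t in `]a, b[) cos (m * t)| <= 2 / `|m|.
Proof.
move=> ab m0; rewrite Rintegral_cos// normrM normfV mulrC.
by rewrite ler_pM2r ?invr_gt0 ?normr_gt0.
Qed.

Lemma norm_Rintegral_sin a b m : a < b -> m != 0 ->
  `|\int[mu]_(t in `]a, b[) sin (m * t)| <= 2 / `|m|.
Proof.
move=> ab m0; rewrite Rintegral_sin// normrM normfV mulrC.
by rewrite ler_pM2r ?invr_gt0 ?normr_gt0.
Qed.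

Lemma lipschitz_deriv F g (x y : R) :
  (forall x : R, is_derive x (1 : R) F (g x)) -> (forall x, `|g x| <= 1) ->
  `|F x - F y| <= `|x - y|.
Proof.
move=> dF g1; wlog xy : x y / x < y => [hw|].
  case: (ltgtP x y) => [/hw//|/hw|->]; last by rewrite !subrr.
  by rewrite distrC (distrC y).
have [c _ cE] : exists2 c, c \in `]x, y[ & F y - F x = g c * (y - x).
  apply: MVT => // z; apply: continuous_subspaceT => {}z.
  by apply/differentiable_continuous/derivable1_diffP; case: (dF z).
by rewrite distrC cE normrM (distrC x) ler_piMl.
Qed.

Lemma cos_lip (x y : R) : `|cos x - cos y| <= `|x - y|.
Proof.
by apply: (lipschitz_deriv (g := fun z => - sin z)) => z; rewrite normrN sin_max.
Qed.

Lemma sin_lip (x y : R) : `|sin x - sin y| <= `|x - y|.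
Proof. by apply: (lipschitz_deriv (g := cos)) => // z; exact: cos_max. Qed.

End TrigIntegral.

(** * Quaternions *)

Section Quaternion.
Variable R : realType.
Local Notation H := (quat R).
Implicit Types (x y i : H) (s t r : R).

Definition dotq x y := qre x * qre y + qi x * qi y + qj x * qj y + qk x * qk y.

Lemma normq_sqr x : (`|x| : R) ^+ 2 = dotq x x.
Proof.
rewrite -[LHS]/(Defs.normq x ^+ 2) /Defs.normq sqr_sqrtr ?addr_ge0 ?sqr_ge0//.
Qed.

Lemma mulqE x y : x * y = Defs.mulq x y. Proof. by []. Qed.

Lemma dotqC x y : dotq x y = dotq y x.
Proof. by rewrite /dotq; ring. Qed.

Lemma dotqDl x y z : dotq (x + y) z = dotq x z + dotq y z.
Proof. by rewrite /dotq/=; ring. Qed.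

Lemma dotqZl r x z : dotq (r *: x) z = r * dotq x z.
Proof. by rewrite /dotq/=; ring. Qed.

Lemma dotqDr x y z : dotq z (x + y) = dotq z x + dotq z y.
Proof. by rewrite dotqC dotqDl !(dotqC z). Qed.

Lemma dotqZr r x z : dotq z (r *: x) = r * dotq z x.
Proof. by rewrite dotqC dotqZl dotqC. Qed.

Lemma dotq_suml (I : Type) (u : seq I) (F : I -> H) y :
  dotq (\sum_(l <- u) F l) y = \sum_(l <- u) dotq (F l) y.
Proof.
elim: u => [|k u IH]; first by rewrite !big_nil /dotq/= !mul0r !addr0.
by rewrite !big_cons dotqDl IH.
Qed.

Lemma dotq_sumr (I : Type) (u : seq I) (F : I -> H) y :
  dotq y (\sum_(l <- u) F l) = \sum_(l <- u) dotq y (F l).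
Proof. by rewrite dotqC dotq_suml; under eq_bigr do rewrite dotqC. Qed.

(** Euler's four-square identity in polarized form; it makes the norm multiplicative. *)
Lemma dotq_mul2 i x y : dotq (i * x) (i * y) = dotq i i * dotq x y.
Proof.
case: i x y => ? ? ? ? [? ? ? ?] [? ? ? ?].
by rewrite !mulqE /dotq/=; ring.
Qed.

Lemma dotq_mulNl i x y : qre i = 0 -> dotq (i * x) y = - dotq x (i * y).
Proof.
case: i x y => a b c d [? ? ? ?] [? ? ? ?] /= ->.
by rewrite !mulqE /dotq/=; ring.
Qed.

Lemma normq_mul x y : `|x * y| = `|x| * `|y| :> R.
Proof.
apply/eqP; rewrite -(eqrXn2 (n := 2))// ?mulr_ge0//; apply/eqP.
by rewrite exprMn !normq_sqr dotq_mul2.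
Qed.

Lemma dotq_le x y : `|dotq x y| <= `|x| * `|y|.
Proof.
rewrite -(@ler_pXn2r _ 2) ?nnegrE ?mulr_ge0// real_normK ?num_real//.
rewrite exprMn !normq_sqr -subr_ge0.
case: x y => a b c d [a' b' c' d']; rewrite /dotq/=.
rewrite [leRHS](_ : _ = (a * b' - b * a') ^+ 2 + (a * c' - c * a') ^+ 2
  + (a * d' - d * a') ^+ 2 + (b * c' - c * b') ^+ 2 + (b * d' - d * b') ^+ 2
  + (c * d' - d * c') ^+ 2); last by ring.
by rewrite !addr_ge0 ?sqr_ge0.
Qed.

(** Real linear functionals of norm at most one. They reduce integrals and limits of
    quaternion-valued functions to real ones, with the same bounds for every coordinate. *)
Record coordinate (c : H -> R) : Prop := Coordinate {
  coordD : forall x y, c (x + y) = c x + c y;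
  coordZ : forall r x, c (r *: x) = r * c x;
  coord_le : forall x, `|c x| <= `|x| }.

Lemma dotq_coordinate (e : H) : `|e| = 1 :> R -> coordinate (dotq e).
Proof.
move=> e1; split=> [x y|r x|x]; [exact: dotqDr|exact: dotqZr|].
by rewrite (le_trans (dotq_le _ _))// e1 mul1r.
Qed.

Let unit_coordinate (e : H) (c : H -> R) :
  dotq e e = 1 -> dotq e = c -> coordinate c.
Proof.
move=> e1 <-; apply: dotq_coordinate.
by apply/eqP; rewrite -(eqrXn2 (n := 2))// normq_sqr e1 expr1n.
Qed.

Lemma qre_coordinate : coordinate (@qre R).
Proof.
apply: (@unit_coordinate (Quat 1 0 0 0)); rewrite /dotq/=; first by ring.
by apply/funext => x; ring.
Qed.

Lemma qi_coordinate : coordinate (@qi R).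
Proof.
apply: (@unit_coordinate (Quat 0 1 0 0)); rewrite /dotq/=; first by ring.
by apply/funext => x; ring.
Qed.

Lemma qj_coordinate : coordinate (@qj R).
Proof.
apply: (@unit_coordinate (Quat 0 0 1 0)); rewrite /dotq/=; first by ring.
by apply/funext => x; ring.
Qed.

Lemma qk_coordinate : coordinate (@qk R).
Proof.
apply: (@unit_coordinate (Quat 0 0 0 1)); rewrite /dotq/=; first by ring.
by apply/funext => x; ring.
Qed.

Lemma coord0 c : coordinate c -> c 0 = 0.
Proof. by move=> cc; rewrite -(scale0r 0) coordZ// mul0r. Qed.

Lemma coordB c x y : coordinate c -> c (x - y) = c x - c y.
Proof. by move=> cc; rewrite -scaleN1r coordD// coordZ// mulN1r. Qed.

Lemma coord_sum c (I : Type) (u : seq I) (F : I -> H) : coordinate c ->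
  c (\sum_(l <- u) F l) = \sum_(l <- u) c (F l).
Proof.
move=> cc; elim: u => [|k u IH]; first by rewrite !big_nil coord0.
by rewrite !big_cons coordD// IH.
Qed.

Lemma coord_cvg c (T : Type) (F : set_system T) (FF : Filter F) (f : T -> H) y :
  coordinate c -> f @ F --> y -> c \o f @ F --> c y.
Proof.
move=> cc /cvgrPdist_lt fy; apply/cvgrPdist_lt => e e0.
apply: filterS (fy e e0) => z; apply: le_lt_trans.
by rewrite -coordB// coord_le.
Qed.

Lemma normq_le_coord x : (`|x| : R) <= `|qre x| + `|qi x| + `|qj x| + `|qk x|.
Proof.
rewrite -(@ler_pXn2r _ 2) ?nnegrE ?addr_ge0// normq_sqr /dotq.
have E (z : R) : z * z = `|z| * `|z| by rewrite -normrM ger0_norm// sqr_ge0.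
rewrite (E (qre x)) (E (qi x)) (E (qj x)) (E (qk x)).
move: (normr_ge0 (qre x)) (normr_ge0 (qi x)) (normr_ge0 (qj x)) (normr_ge0 (qk x)).
move: `|qre x| `|qi x| `|qj x| `|qk x| => a b c d a0 b0 c0 d0.
have := mulr_ge0 a0 b0; have := mulr_ge0 a0 c0; have := mulr_ge0 a0 d0.
have := mulr_ge0 b0 c0; have := mulr_ge0 b0 d0; have := mulr_ge0 c0 d0.
by nra.
Qed.

Lemma cvg_coord (T : Type) (F : set_system T) (FF : Filter F) (f : T -> H) y :
  (@qre R) \o f @ F --> qre y -> (@qi R) \o f @ F --> qi y ->
  (@qj R) \o f @ F --> qj y -> (@qk R) \o f @ F --> qk y -> f @ F --> y.
Proof.
move=> /cvgrPdist_lt f1 /cvgrPdist_lt f2 /cvgrPdist_lt f3 /cvgrPdist_lt f4.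
apply/cvgrPdist_lt => e e0; have e4 : 0 < e / 4 by rewrite divr_gt0.
near=> z; apply: (le_lt_trans (normq_le_coord _)).
have -> : e = e / 4 + e / 4 + e / 4 + e / 4 by field.
apply: ltrD; [apply: ltrD; [apply: ltrD|]|].
- by near: z; exact: f1.
- by near: z; exact: f2.
- by near: z; exact: f3.
- by near: z; exact: f4.
Unshelve. all: by end_near. Qed.

Lemma expq_mul i t x : expq i t * x = cos t *: x + sin t *: (i * x).
Proof. by rewrite /expq mulrDl -scalerAl mul1r -scalerAl. Qed.

(** Left multiplication by [expq i s] is a rotation, so only the difference of the angles matters;
    the sine term appears because multiplication by [i] is skew-adjoint. *)
Lemma dotq_expq i s t x y : imag_sphere i ->
  dotq (expq i s * x) (expq i t * y) =
    cos (t - s) * dotq x y + sin (t - s) * dotq x (i * y).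
Proof.
move=> [i0 i1]; rewrite !expq_mul !dotqDl !dotqDr !dotqZl !dotqZr.
rewrite dotq_mul2 -normq_sqr i1 expr1n mul1r (dotq_mulNl _ _ i0) cosB sinB.
by ring.
Qed.

Lemma normq_expq i t x : imag_sphere i -> `|expq i t * x| = `|x| :> R.
Proof.
move=> is1; apply/eqP; rewrite -(eqrXn2 (n := 2))//.
by rewrite !normq_sqr dotq_expq// subrr cos0 sin0 mul1r mul0r addr0.
Qed.

Lemma normq_expq1 i t : imag_sphere i -> `|expq i t| = 1 :> R.
Proof.
move=> is1; rewrite -[expq i t]mulr1 normq_expq//.
by apply/eqP; rewrite -(eqrXn2 (n := 2))// normq_sqr /dotq/= !mulr0 !addr0 mulr1 expr1n.
Qed.

Lemma expq_lip i s t x : imag_sphere i ->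
  (`|expq i s * x - expq i t * x| : R) <= 2 * `|s - t| * `|x|.
Proof.
move=> [_ i1]; rewrite !expq_mul opprD addrACA -!scalerBl.
rewrite (le_trans (ler_normD _ _))// !normrZ normq_mul i1 mul1r -mulrDl.
by rewrite ler_wpM2r// mulr_natl mulr2n lerD ?cos_lip ?sin_lip.
Qed.

(** De Moivre's formula, from [i * i = - 1]. *)
Lemma expq_pow i t r n : imag_sphere i ->
  (r *: expq i t) ^+ n = r ^+ n *: expq i (n%:R * t).
Proof.
move=> is1; rewrite exprZn; congr (_ *: _); elim: n => [|n IH].
  by rewrite expr0 /expq mul0r cos0 sin0 scale0r addr0 scale1r.
have ii : i * i = - 1.
  have := normq_sqr i; case: is1 => i0 ->; rewrite expr1n.
  case: i i0 {IH} => a b c d /= -> E; rewrite mulqE /=.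
  congr Quat => /=; [by rewrite E /dotq/=; ring|by ring|by ring|by ring].
rewrite exprS IH /expq mulrDl !mulrDr -!scalerAl -!scalerAr !mul1r mulr1 ii.
rewrite -natr1 mulrDl mul1r (addrC _ t) cosD sinD !scalerA.
rewrite scalerBl scalerDl scalerN.
by rewrite addrACA [RHS]addrACA (addrC (- _)).
Qed.

End Quaternion.

(** * Mean squares of lacunary sums *)

Section Energy.
Variable R : realType.
Local Notation H := (quat R).
Local Notation mu := (@lebesgue_measure R).
Implicit Types (nu : nat -> R) (c : nat -> H) (i : H).

Lemma cvg_sumr (V : normedModType R) (I T : Type) (s : seq I)
    (F : set_system T) {FF : Filter F} (g : I -> T -> V) (y : I -> V) :
  (forall k, g k x @[x --> F] --> y k) ->
  (\sum_(k <- s) g k x) @[x --> F] --> \sum_(k <- s) y k.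
Proof. by move=> gy; apply: cvg_big => [|k _]; [exact: add_continuous|]. Qed.

Definition trig i nu c m N (t : R) : H :=
  \sum_(m <= l < N) expq i (nu l * t) * c l.

Lemma continuous_trig i nu c m N : continuous (trig i nu c m N).
Proof.
rewrite /trig => t; apply: cvg_sumr => l /=.
under eq_fun do rewrite expq_mul.
rewrite expq_mul; apply: cvgD; apply: cvgZr_tmp.
  exact: continuous_cosM.
exact: continuous_sinM.
Qed.

Lemma continuous_normq_sqr (g : R -> H) :
  continuous g -> continuous (fun t => `|g t| ^+ 2 : R).
Proof.
move=> cg t; apply: (@continuous_comp _ _ _ (fun t => `|g t| : R) (fun y => y ^+ 2)).
  exact: (@continuous_comp _ _ _ g (fun x => `|x| : R) t (cg t)
    (@norm_continuous _ _ _)).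
exact: exprn_continuous.
Qed.

Lemma trig_sqr i nu c m N t : imag_sphere i ->
  `|trig i nu c m N t| ^+ 2 = \sum_(m <= k < N) \sum_(m <= l < N)
    (dotq (c k) (c l) * cos ((nu l - nu k) * t) +
     dotq (c k) (i * c l) * sin ((nu l - nu k) * t)) :> R.
Proof.
move=> is1; rewrite normq_sqr /trig dotq_suml; apply: eq_bigr => k _.
rewrite dotq_sumr; apply: eq_bigr => l _.
by rewrite dotq_expq// -mulrBl mulrC [X in _ + X]mulrC.
Qed.

Lemma Rintegral_oo_sum (I : Type) (s : seq I) (g : I -> R -> R) (a b : R) :
  (forall k, continuous (g k)) ->
  \int[mu]_(t in `]a, b[) (\sum_(k <- s) g k t) =
  \sum_(k <- s) \int[mu]_(t in `]a, b[) g k t.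
Proof.
move=> cg; elim: s => [|k s IH].
  rewrite big_nil; under eq_Rintegral do rewrite big_nil.
  by rewrite Rintegral_cst// mul0r.
rewrite big_cons -IH -RintegralD//.
- by apply: eq_Rintegral => t _; rewrite big_cons.
- exact: continuous_integrable_oo.
- apply: continuous_integrable_oo => t; apply: cvg_sumr => j; exact: cg.
Qed.

Lemma trig_energy i nu c m N (a b : R) : imag_sphere i ->
  \int[mu]_(t in `]a, b[) `|trig i nu c m N t| ^+ 2 =
  \sum_(m <= k < N) \sum_(m <= l < N)
    (dotq (c k) (c l) * \int[mu]_(t in `]a, b[) cos ((nu l - nu k) * t) +
     dotq (c k) (i * c l) * \int[mu]_(t in `]a, b[) sin ((nu l - nu k) * t)).
Proof.
move=> is1; under eq_Rintegral do rewrite trig_sqr//.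
have cg k l : continuous (fun t => dotq (c k) (c l) * cos ((nu l - nu k) * t) +
     dotq (c k) (i * c l) * sin ((nu l - nu k) * t)).
  move=> t; apply: cvgD; apply: cvgMl_tmp.
    exact: continuous_cosM.
  exact: continuous_sinM.
rewrite Rintegral_oo_sum; last first.
  by move=> k t; apply: cvg_sumr => l; exact: cg.
apply: eq_bigr => k _; rewrite Rintegral_oo_sum//; apply: eq_bigr => l _.
rewrite RintegralD//.
- rewrite RintegralZl//; last exact/continuous_integrable_oo/continuous_cosM.
  by rewrite RintegralZl//; exact/continuous_integrable_oo/continuous_sinM.
- apply: continuous_integrable_oo => t; apply: cvgMl_tmp; exact: continuous_cosM.
- apply: continuous_integrable_oo => t; apply: cvgMl_tmp; exact: continuous_sinM.
Qed.

Lemma cos_sin_2pi_nat (n : nat) :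
  cos (n%:R * (2 * pi)) = 1 :> R /\ sin (n%:R * (2 * pi)) = 0 :> R.
Proof.
elim: n => [|n [IHc IHs]]; first by rewrite mul0r cos0 sin0.
rewrite -natr1 mulrDl mul1r cosD sinD IHc IHs mulr_natl cos2pi sin2pi.
by split; ring.
Qed.

Lemma trig_energy_2pi i (n : nat -> nat) c N : imag_sphere i -> injective n ->
  \int[mu]_(t in `]0, 2 * pi[) `|trig i (fun l => (n l)%:R) c 0 N t| ^+ 2 =
  2 * pi * \sum_(0 <= l < N) `|c l| ^+ 2.
Proof.
move=> is1 n_inj; rewrite trig_energy// mulr_sumr.
have pi2 : 0 < 2 * pi :> R by rewrite mulr_gt0 ?pi_gt0.
rewrite big_nat [RHS]big_nat; apply: eq_bigr => k /andP[_ kN].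
rewrite (bigD1_seq k) ?mem_index_iota ?iota_uniq//= big1 ?addr0 => [|l lk].
  under eq_Rintegral do rewrite subrr mul0r cos0.
  under [X in _ + _ * X]eq_Rintegral do rewrite subrr mul0r sin0.
  by rewrite !Rintegral_oo_cst ?ltW// subr0 mul0r mulr0 addr0 mul1r normq_sqr mulrC.
have nkl : (n l)%:R - (n k)%:R != 0 :> R.
  by rewrite subr_eq0 eqr_nat; apply: contra lk => /eqP/n_inj ->.
have [cl sl] := cos_sin_2pi_nat (n l); have [ck sk] := cos_sin_2pi_nat (n k).
rewrite Rintegral_cos// Rintegral_sin// mulr0 cos0 sin0 mulrBl cosB sinB cl sl ck sk.
by rewrite !(mulr0, mul0r, mulr1, addr0, subr0, subrr).
Qed.

(* Since [nu l - nu k] is comparable to [nu l] for [k < l], the off-diagonal terms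
   are controlled by Schur's test with the kernel [1 / max (nu k, nu l)]. *)
Lemma trig_energy_le A i nu c m N (a b : R) : imag_sphere i ->
  1 < A -> (forall l, 0 < nu l) -> (forall l, A * nu l <= nu l.+1) ->
  1 <= nu m * (b - a) ->
  \int[mu]_(t in `]a, b[) `|trig i nu c m N t| ^+ 2 <=
  (8 * lac_const A ^+ 2 + 1) * (b - a) * \sum_(m <= l < N) `|c l| ^+ 2.
Proof.
move=> is1 A1 nu0 nuA mab; rewrite trig_energy//.
set C := lac_const A.
have C0 : 0 < C by exact: lac_const_gt0.
have ab0 : 0 < b - a by rewrite -(pmulr_rgt0 _ (nu0 m)) (lt_le_trans ltr01).
have ab : a < b by rewrite -subr_gt0.
pose x k : R := `|c k|; pose w k l := (nu (maxn k l))^-1.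
have w0 k l : 0 <= w k l by rewrite invr_ge0 ltW.
have wC k l : w k l = w l k by rewrite /w maxnC.
(* The difference of two frequencies is at least the fraction [1 - 1 / A = 1 / C] of the larger
   one. *)
have gap k l : k != l -> (`|nu l - nu k|)^-1 <= C * w k l.
  wlog kl : k l / (k < l)%N => [hw|_].
    rewrite neq_ltn => /orP[kl|lk]; first by apply: hw => //; rewrite ltn_eqF.
    by rewrite distrC wC; apply: hw => //; rewrite ltn_eqF.
  have g := lac_gap A1 nu0 nuA kl.
  have A0 : 0 < 1 - A^-1 by rewrite subr_gt0 invf_lt1// (lt_trans ltr01).
  have p0 : 0 < (1 - A^-1) * nu l by rewrite mulr_gt0.
  rewrite ger0_norm ?(le_trans (ltW p0))// /w (maxn_idPr (ltnW kl)).
  have -> : C = (1 - A^-1)^-1.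
    by rewrite /C /lac_const; field; rewrite !gt_eqF// ?subr_gt0// (lt_trans ltr01).
  by rewrite -invfM lef_pV2// posrE (lt_le_trans p0).
(* Row sums of the kernel. The [k - m] indices below [k] weigh [1 / nu k] each, at most [C / nu m]
   together by [lac_bernoulli]; those from [k] on weigh at most [C / nu k]. Both are at most
   [C * (b - a)], since the interval is at least [1 / nu m] long. *)
have wsum k : (m <= k < N)%N -> \sum_(m <= l < N) w k l <= 2 * C * (b - a).
  move=> /andP[mk kN]; have nuk0 := nu0 k.
  have num : (nu m)^-1 <= b - a by rewrite -div1r ler_pdivrMr// mulrC.
  rewrite (@big_cat_nat _ _ _ k) ?(ltnW kN)//=.
  have -> : 2 * C * (b - a) = C * (b - a) + C * (b - a) by ring.
  apply: lerD; last first.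
    apply: (@le_trans _ _ (C / nu k)).
      apply: le_trans (lac_sum_inv A1 nu0 nuA k N).
      by apply: ler_sum_nat => l /andP[kl _]; rewrite /w (maxn_idPr kl).
    rewrite ler_wpM2l ?(ltW C0)// (le_trans _ num)// lef_pV2 ?posrE//.
    exact: (lac_incr A1 nu0 nuA).
  apply: (@le_trans _ _ (C * (nu m)^-1)); last by rewrite ler_wpM2l ?(ltW C0).
  rewrite (@eq_big_nat _ _ _ _ _ _ (fun=> (nu k)^-1)); last first.
    by move=> l /andP[_ lk]; rewrite /w (maxn_idPl (ltnW lk)).
  rewrite sumr_const_nat -[_ *+ _]mulr_natl ler_pdivrMr// mulrAC ler_pdivlMr//.
  have := lac_bernoulli A1 nu0 nuA m (k - m); rewrite subnKC//.
  move: (k - m)%N => d dk; rewrite /C /lac_const mulrAC ler_pdivlMr ?subr_gt0//.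
  have A0 : 0 <= A by rewrite ltW// (lt_trans ltr01).
  apply: (@le_trans _ _ (nu k)); last by rewrite ler_peMl ?ltW.
  apply: le_trans dk; rewrite mulrAC ler_wpM2r ?(ltW (nu0 m))//.
  by rewrite lerDr.
(* Off the diagonal, each of the two integrals is at most [2 * C * w k l], and [x k * x l] is at
   most half the sum of the squares. *)
have term k l : dotq (c k) (c l) * \int[mu]_(t in `]a, b[) cos ((nu l - nu k) * t) +
     dotq (c k) (i * c l) * \int[mu]_(t in `]a, b[) sin ((nu l - nu k) * t)
   <= (x k ^+ 2 * (b - a)) *+ (k == l) + 2 * C * (x k ^+ 2 * w k l + x l ^+ 2 * w k l).
  have [<-|kl] := eqVneq k l.
    under eq_Rintegral do rewrite subrr mul0r cos0.
    under [X in _ * _ + _ * X]eq_Rintegral do rewrite subrr mul0r sin0.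
    rewrite !Rintegral_oo_cst ?(ltW ab)// mul0r mulr0 addr0 mul1r mulr1n.
    rewrite -normq_sqr ler_wpDr// mulr_ge0 ?(ltW C0)//.
      by rewrite mulr_ge0 ?(ltW C0).
    by rewrite addr_ge0// mulr_ge0 ?sqr_ge0.
  rewrite mulr0n add0r.
  have kl0 : nu l - nu k != 0.
    rewrite -normr_gt0 -invr_gt0 lt_neqAle invr_ge0 normr_ge0 andbT eq_sym.
    rewrite invr_eq0 normr_eq0 subr_eq0.
    move: kl; rewrite neq_ltn => /orP[] /(lac_gap A1 nu0 nuA) h; apply/eqP => E;
      move: h; rewrite E subrr leNgt mulr_gt0// subr_gt0 invf_lt1//;
      exact: lt_trans A1.
  have d1 : `|dotq (c k) (c l)| <= x k * x l by exact: dotq_le.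
  have d2 : `|dotq (c k) (i * c l)| <= x k * x l.
    by rewrite (le_trans (dotq_le _ _))// normq_mul (proj2 is1) mul1r.
  have x2 : x k * x l <= (x k ^+ 2 + x l ^+ 2) / 2.
    by have := sqr_ge0 (x k - x l); rewrite sqrrB; lra.
  have i1 := norm_Rintegral_cos ab kl0; have i2 := norm_Rintegral_sin ab kl0.
  apply: (@le_trans _ _ (x k * x l * (2 / `|nu l - nu k|) * 2)).
    rewrite [leRHS]mulr_natr mulr2n; apply: lerD;
      apply: (le_trans (ler_norm _)); rewrite normrM ler_pM//.
  have -> : 2 * C * (x k ^+ 2 * w k l + x l ^+ 2 * w k l) =
    (x k ^+ 2 + x l ^+ 2) / 2 * (2 * (C * w k l)) * 2 by field.
  rewrite ler_wpM2r// ler_pM// ?mulr_ge0 ?invr_ge0 ?normr_ge0//.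
  by rewrite ler_wpM2l// gap.
apply: (@le_trans _ _ (\sum_(m <= k < N) \sum_(m <= l < N)
   ((x k ^+ 2 * (b - a)) *+ (k == l) + 2 * C * (x k ^+ 2 * w k l + x l ^+ 2 * w k l)))).
  by apply: ler_sum => k _; apply: ler_sum => l _; exact: term.
have -> : \sum_(m <= k < N) \sum_(m <= l < N)
   ((x k ^+ 2 * (b - a)) *+ (k == l) + 2 * C * (x k ^+ 2 * w k l + x l ^+ 2 * w k l)) =
  \sum_(m <= k < N) x k ^+ 2 * (b - a) +
  2 * C * (2 * \sum_(m <= k < N) (x k ^+ 2 * \sum_(m <= l < N) w k l)).
  under eq_bigr do rewrite big_split/= -mulr_sumr big_split/=.
  rewrite big_split/= -mulr_sumr big_split/=; congr (_ + _ * _).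
    rewrite big_nat [RHS]big_nat; apply: eq_bigr => k kN.
    rewrite (bigD1_seq k) ?mem_index_iota ?iota_uniq//= eqxx mulr1n big1 ?addr0//.
    by move=> l; rewrite eq_sym => /negbTE ->.
  rewrite [X in _ + X]exchange_big/= mulr_natl mulr2n; congr (_ + _).
    by apply: eq_bigr => k _; rewrite mulr_sumr.
  by apply: eq_bigr => k _; rewrite mulr_sumr; under eq_bigr do rewrite wC.
rewrite -mulr_suml; set X := \sum_(m <= k < N) x k ^+ 2.
(* The diagonal contributes the 1 of the final constant; [2 * C] times the two equal halves of the
   symmetric sum times the row bound [2 * C] gives [8 * C ^+ 2]. *)
apply: (@le_trans _ _ (X * (b - a) + 2 * C * (2 * (X * (2 * C * (b - a)))))).
  rewrite lerD2l; apply: ler_wpM2l; first by rewrite mulr_ge0 ?(ltW C0).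
  apply: ler_wpM2l => //.
  rewrite mulr_suml; apply: ler_sum_nat => k kN.
  by rewrite ler_wpM2l ?sqr_ge0// wsum.
by rewrite le_eqVlt; apply/orP; left; apply/eqP; rewrite -/X; ring.
Qed.

End Energy.

(** * Almost everywhere limits *)

Section RieszFischer.
Variable R : realType.
Local Notation mu := (@lebesgue_measure R).

Lemma sum_halves n : \sum_(0 <= k < n) 2^-1 ^+ k <= 2 :> R.
Proof.
suff -> : \sum_(0 <= k < n) 2^-1 ^+ k = 2 - 2 * 2^-1 ^+ n :> R.
  by rewrite gerBl mulr_ge0// exprn_ge0// invr_ge0.
elim: n => [|n IH]; first by rewrite big_geq// expr0; ring.
by rewrite big_nat_recr//= IH exprS; field.
Qed.

Lemma cvg_EFin_real (T : Type) (F : set_system T) {FF : Filter F} (g : T -> R) (l : R) :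
  g x @[x --> F] --> l -> (g x)%:E @[x --> F] --> l%:E.
Proof. by move=> gl; apply: cvg_EFin => //; exact: nearW. Qed.

Lemma ae_mono (P Q : R -> Prop) : (forall t, P t -> Q t) ->
  {ae mu, forall t, P t} -> {ae mu, forall t, Q t}.
Proof.
by move=> PQ; apply: negligibleS => t /=; apply: contra_not; exact: PQ.
Qed.

Lemma ae_mono2 (P P' Q : R -> Prop) : (forall t, P t -> P' t -> Q t) ->
  {ae mu, forall t, P t} -> {ae mu, forall t, P' t} -> {ae mu, forall t, Q t}.
Proof.
move=> PQ hP hP'; apply: negligibleS (negligibleU hP hP') => t /= nQ.
by have [Pt|] := pselect (P t); [right|left] => // /(PQ _ Pt).
Qed.

Lemma ae_bounded_itv (P : R -> Prop) :
  (forall a b : R, a < b -> {ae mu, forall t, `]a, b[%classic t -> P t}) ->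
  {ae mu, forall t, P t}.
Proof.
move=> h.
have hM : {ae mu, forall t, forall M, `](- M.+1%:R : R), M.+1%:R[%classic t -> P t}.
  by apply: ae_foralln => M; apply: h; rewrite gtrN.
apply: ae_mono hM => t Pt; apply: (Pt (Num.bound `|t|)) => /=; rewrite in_itv/=.
rewrite -ltr_norml -natr1.
by rewrite (lt_trans (archi_boundP (normr_ge0 t)))// ltrDl.
Qed.

Variable u : nat -> R -> R.
Hypothesis u_cont : forall k, continuous (u k).
Hypothesis u_cauchy : forall a b : R, a < b -> exists K : R, forall k,
  \int[mu]_(t in `]a, b[) (u k.+1 t - u k t) ^+ 2 <= K * (4^-1) ^+ k.

(* An upper limit, so that [L1_lim] is Borel even where the sequence diverges. *)
Definition L1_lim (t : R) : R := fine (limn_esup (fun k => (u k t)%:E)).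

Lemma measurable_L1_lim : measurable_fun setT L1_lim.
Proof.
apply: (measurableT_comp (@fine_measurable _ _ _)) => //.
apply: measurable_fun_limn_esup => k; apply/measurable_EFinP.
exact: continuous_measurable_fun.
Qed.

Lemma L1_limE t l : u k t @[k --> \oo] --> l -> L1_lim t = l.
Proof.
move=> ul; rewrite /L1_lim.
have /cvg_limn_einf_sup[_ ->//] : (u k t)%:E @[k --> \oo] --> l%:E.
exact: cvg_EFin_real.
Qed.

(** Where it is finite the sequence converges absolutely, and [|u 0|] plus it dominates every [u k].
    Its integrability on bounded intervals thus gives both the limit and the passage to the limit
    under the integral. *)
Let variation t := (\sum_(0 <= k <oo) `|u k.+1 t - u k t|%:E)%E.

Let cont_variation k : continuous (fun t => u k.+1 t - u k t).
Proof. by move=> t; apply: cvgB; exact: u_cont. Qed.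

Let mEFin (g : R -> R) D : continuous g -> measurable_fun D (EFin \o g).
Proof.
move=> cg; apply/measurable_EFinP; apply: measurable_funTS.
exact: continuous_measurable_fun.
Qed.

Let integrable_variation a b : a < b -> mu.-integrable `]a, b[ variation.
Proof.
move=> ab; have cn k : continuous (fun t => `|u k.+1 t - u k t|).
  move=> t; apply: (@continuous_comp _ _ _ (fun t => u k.+1 t - u k t) Num.norm).
    exact: cont_variation.
  exact: norm_continuous.
have mn k : measurable_fun (`]a, b[ : set R) (fun t => `|u k.+1 t - u k t|%:E).
  exact: mEFin.
apply/integrableP; split.
  apply: (eq_measurable_fun (fun t =>
    limn_esup (fun n => \sum_(0 <= k < n) `|u k.+1 t - u k t|%:E)%E)).
    by move=> t _; rewrite is_cvg_limn_esupE//; exact: is_cvg_nneseries.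
  by apply: measurable_fun_limn_esup => n; exact: emeasurable_sum.
under eq_integral do rewrite gee0_abs ?nneseries_ge0//.
rewrite integral_nneseries//.
have [K uK] := u_cauchy ab.
apply: (@le_lt_trans _ _ ((b - a + K) * 2)%:E); last exact: ltry.
apply: lime_le; first by apply: is_cvg_nneseries => k _ _; exact: integral_ge0.
apply: nearW => n.
(* The inequality [|d| <= p + d^2 / p] with [p = 2^-k] plays the role of Cauchy-Schwarz: it turns
   the rate [4^-k] of the squares into [2^-k]. *)
have bound k : (\int[mu]_(t in `]a, b[) `|u k.+1 t - u k t|%:E <=
    ((b - a + K) * 2^-1 ^+ k)%:E)%E.
  have h0 : 0 < 2^-1 ^+ k :> R by rewrite exprn_gt0 ?invr_gt0.
  have csq : continuous (fun t => 2 ^+ k * (u k.+1 t - u k t) ^+ 2).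
    move=> t; apply: cvgMl_tmp.
    apply: (@continuous_comp _ _ _ (fun t => u k.+1 t - u k t) (fun y : R => y ^+ 2)).
      exact: cont_variation.
    exact: exprn_continuous.
  have ccst : continuous (fun _ : R => 2^-1 ^+ k : R) by move=> t; exact: cvg_cst.
  rewrite -[leLHS]fineK; last exact/integrable_fin_num/continuous_integrable_oo.
  rewrite lee_fin.
  apply: (@le_trans _ _ (\int[mu]_(t in `]a, b[)
      (2^-1 ^+ k + 2 ^+ k * (u k.+1 t - u k t) ^+ 2))).
    apply: le_Rintegral => //; first exact: continuous_integrable_oo.
      by apply: continuous_integrable_oo => t; apply: cvgD; [exact: ccst|exact: csq].
    move=> t _; set d := u k.+1 t - u k t.
    have -> : d ^+ 2 = `|d| ^+ 2 by rewrite real_normK ?num_real.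
    have := normr_ge0 d; move: `|d| => e e0.
    have pq : 2^-1 ^+ k * 2 ^+ k = 1 :> R by rewrite -exprMn mulVf// expr1n.
    move: (2^-1 ^+ k) (2 ^+ k) h0 pq => p q p0 pq.
    suff : p * e <= p * (p + q * e ^+ 2) by rewrite ler_pM2l.
    rewrite mulrDr (mulrA p q) pq mul1r.
    by have := sqr_ge0 (e - p); nra.
  rewrite RintegralD//; [|exact: continuous_integrable_oo..].
  rewrite Rintegral_oo_cst ?(ltW ab)// mulrDl (mulrC _ (b - a)) lerD2l.
  rewrite RintegralZl//; last first.
    apply: continuous_integrable_oo => t.
    apply: (@continuous_comp _ _ _ (fun t => u k.+1 t - u k t) (fun y : R => y ^+ 2)).
      exact: cont_variation.
    exact: exprn_continuous.
  apply: (le_trans (ler_wpM2l _ (uK k))); first by rewrite exprn_ge0.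
  rewrite mulrCA; rewrite [X in _ * X](_ : _ = 2^-1 ^+ k)//.
  rewrite -exprMn; congr (_ ^+ _); by field.
apply: (@le_trans _ _ (\sum_(0 <= k < n) ((b - a + K) * 2^-1 ^+ k)%:E)%E).
  by apply: lee_sum => k _; exact: bound.
rewrite sumEFin lee_fin -mulr_sumr ler_wpM2l ?sum_halves//.
(* The remaining goal [0 <= b - a + K] is read off from [bound] at index 0, whose left side is
   nonnegative. *)
have := bound 0%N; rewrite expr0 mulr1 => /(le_trans _) => /(_ 0%E).
by rewrite lee_fin; apply; exact: integral_ge0.
Qed.

Let variation_cvg t : variation t \is a fin_num ->
  u k t @[k --> \oo] --> L1_lim t.
Proof.
move=> vt; suff cu : cvgn (u ^~ t) by rewrite (L1_limE cu).
have -> : u ^~ t = (fun n => u 0%N t + series (fun k => u k.+1 t - u k t) n).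
  by apply/funext => n; rewrite /series/= telescope_sumr// addrC subrK.
apply: is_cvgD; first exact: is_cvg_cst.
apply: normed_cvg; apply: nondecreasing_is_cvgn.
  by apply: nondecreasing_series => k _ _ /=; exact: normr_ge0.
exists (fine (variation t)) => _ [n _ <-].
rewrite -lee_fin fineK// /= -sumEFin.
exact: nneseries_lim_ge.
Qed.

Lemma L1_lim_cvg : {ae mu, forall t, u k t @[k --> \oo] --> L1_lim t}.
Proof.
apply: ae_bounded_itv => a b ab.
have h := integrable_ae _ (integrable_variation ab).
by apply: ae_mono (h _) => // t {}h /h; exact: variation_cvg.
Qed.

Let dominated a b : a < b ->
  mu.-integrable `]a, b[ (EFin \o L1_lim) /\
  ((\int[mu]_(t in `]a, b[) (u k t)%:E)%E @[k --> \oo] -->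
   (\int[mu]_(t in `]a, b[) (L1_lim t)%:E)%E).
Proof.
move=> ab.
have c0 : continuous (fun t => `|u 0%N t|).
  move=> t; apply: (@continuous_comp _ _ _ (u 0%N) Num.norm); first exact: u_cont.
  exact: norm_continuous.
have [||||||h1 _ h2] := @dominated_convergence _ _ _ mu `]a, b[ _ (fun k => EFin \o u k)
   (EFin \o L1_lim) (fun t => `|u 0%N t|%:E + variation t)%E; last by [].
- by [].
- by move=> k; exact: mEFin.
- by apply/measurable_EFinP/measurable_funTS; exact: measurable_L1_lim.
- by apply: ae_mono L1_lim_cvg => t ut _; exact: cvg_EFin_real.
- apply: integrableD => //; last exact: integrable_variation.
  exact: continuous_integrable_oo.
- apply: aeW => t n _ /=.
  have -> : u n t = u 0%N t + \sum_(0 <= k < n) (u k.+1 t - u k t).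
    by rewrite telescope_sumr// addrC subrK.
  apply: (@le_trans _ _ (`|u 0%N t|%:E + (\sum_(0 <= k < n) `|u k.+1 t - u k t|)%:E)%E).
    by rewrite -EFinD lee_fin (le_trans (ler_normD _ _))// lerD2l ler_norm_sum.
  by rewrite leeD2l// -sumEFin; exact: nneseries_lim_ge.
Qed.

Lemma L1_lim_integrable a b : a < b -> mu.-integrable `]a, b[ (EFin \o L1_lim).
Proof. by move=> /dominated[]. Qed.

Lemma L1_lim_Rintegral a b : a < b ->
  \int[mu]_(t in `]a, b[) u k t @[k --> \oo] --> \int[mu]_(t in `]a, b[) L1_lim t.
Proof.
move=> ab; have [iL cL] := dominated ab; apply: fine_cvg.
by rewrite fineK// integrable_fin_num.
Qed.

End RieszFischer.

(** * Radial limits *)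

Section RadialLimit.
Variable R : realType.
Local Notation H := (quat R).
Local Notation mu := (@lebesgue_measure R).
Implicit Types (i x : H) (c : H -> R).

Lemma onem_expr_ge (h : R) n : 0 <= h <= 1 -> 1 - n%:R * h <= (1 - h) ^+ n.
Proof.
move=> /andP[h0 h1]; elim: n => [|n IH]; first by rewrite expr0 mul0r subr0.
rewrite exprS (le_trans _ (ler_wpM2l _ IH)) ?subr_ge0// -natr1.
have : 0 <= n%:R * h ^+ 2 :> R by rewrite mulr_ge0 ?sqr_ge0.
by nra.
Qed.

(** Bernoulli gives [n h <= (1 + h)^n], and [(1 - h^2)^n <= 1]. *)
Lemma onem_expr_le (h : R) n : 0 <= h <= 1 -> n%:R * h * (1 - h) ^+ n <= 1.
Proof.
move=> /andP[h0 h1].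
have bern : n%:R * h <= (1 + h) ^+ n.
  apply: (@le_trans _ _ (1 + n%:R * h)); first by rewrite lerDr.
  elim: n => [|n IH]; first by rewrite expr0 mul0r addr0.
  rewrite exprS (le_trans _ (ler_wpM2l _ IH)) ?addr_ge0// -natr1.
  have : 0 <= n%:R * h ^+ 2 :> R by rewrite mulr_ge0 ?sqr_ge0.
  by nra.
have p0 : 0 <= (1 - h) ^+ n by rewrite exprn_ge0// subr_ge0.
rewrite (le_trans (ler_wpM2r p0 bern))// -exprMn.
by apply: exprn_ile1; nra.
Qed.

Lemma continuous_coord_expq c i x (m : R) : coordinate c ->
  continuous (fun s : R => c (expq i (m * s) * x)).
Proof.
move=> cc s; apply: coord_cvg => //.
under eq_fun do rewrite expq_mul.
rewrite expq_mul; apply: cvgD; apply: cvgZr_tmp.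
  exact: continuous_cosM.
exact: continuous_sinM.
Qed.

(* Averaging over [t - h, t + h] and taking the radius 1 - h multiply the
   frequency n by factors that are both 1 + O(nh) and O(1/(nh)). *)
Lemma avg_expq_radial c i x n (t h : R) : coordinate c -> imag_sphere i ->
  (0 < n)%N -> 0 < h -> h <= 1 ->
  `|(2 * h)^-1 * (\int[mu]_(s in `]t - h, t + h[) c (expq i (n%:R * s) * x)) -
    (1 - h) ^+ n * c (expq i (n%:R * t) * x)| <=
  3 * `|x| * Num.min (n%:R * h) (n%:R * h)^-1.
Proof.
move=> cc is1 n0 h0 h1.
have n0R : 0 < n%:R :> R by rewrite ltr0n.
have nh0 : 0 < n%:R * h by rewrite mulr_gt0.
have ab : t - h < t + h by rewrite ltrD2l gtrN.
have h2 : t + h - (t - h) = 2 * h by ring.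
have h20 : 0 < 2 * h by rewrite mulr_gt0.
have ce := @continuous_coord_expq c i x n%:R cc.
set I := \int[mu]_(s in _) _; set y := expq i (n%:R * t) * x.
have cy : `|c y| <= `|x| by rewrite (le_trans (coord_le cc y))// normq_expq.
have r01 : 0 <= h <= 1 by rewrite (ltW h0).
have p0 : 0 <= (1 - h) ^+ n by rewrite exprn_ge0// subr_ge0.
have p1 : (1 - h) ^+ n <= 1 by rewrite exprn_ile1 ?subr_ge0// gerBl ltW.
rewrite minr_pMr ?mulr_ge0// le_min; apply/andP; split.
(* Small [n h]: both terms are compared with [c y]. The constant 3 is 2 from the Lipschitz bound of
   [expq_lip] plus 1 from Bernoulli's inequality. *)
- have -> : (2 * h)^-1 * I - (1 - h) ^+ n * c y =
    (2 * h)^-1 * (I - c y * (2 * h)) + (1 - (1 - h) ^+ n) * c y.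
    by field; rewrite gt_eqF.
  have -> : 3 * `|x| * (n%:R * h) =
    (2 * h)^-1 * (2 * (n%:R * h) * `|x| * (2 * h)) + (n%:R * h) * `|x|.
    by field; rewrite gt_eqF.
  apply: (le_trans (ler_normD _ _)); apply: lerD; last first.
    rewrite normrM; apply: ler_pM => //.
    rewrite ger0_norm ?subr_ge0//.
    by have := onem_expr_ge n r01; lra.
  rewrite normrM gtr0_norm ?invr_gt0// ler_pM2l ?invr_gt0//.
  have cst_cont (z : R) : continuous (fun _ : R => z) by move=> u; exact: cvg_cst.
  have cB : continuous (fun s : R => c (expq i (n%:R * s) * x) - c y).
    by move=> s; apply: cvgB; [exact: ce|exact: cst_cont].
  rewrite -h2 -!Rintegral_oo_cst ?(ltW ab)// -RintegralB//;
    [|exact: continuous_integrable_oo..].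
  rewrite (le_trans (le_normr_Rintegral _ _))//; first exact: continuous_integrable_oo.
  apply: le_Rintegral => //; [| exact: continuous_integrable_oo|].
    apply: continuous_integrable_oo => s.
    apply: (@continuous_comp _ _ _ 
      (fun s : R => c (expq i (n%:R * s) * x) - c y) Num.norm).
      exact: cB.
    exact: norm_continuous.
  move=> s /=; rewrite in_itv/= => /andP[s1 s2]; rewrite -coordB//.
  rewrite (le_trans (coord_le cc _))// (le_trans (expq_lip _ _ _ is1))//.
  rewrite ler_wpM2r// ler_wpM2l// -mulrBr normrM ger0_norm// ler_wpM2l//.
  by rewrite ler_norml; apply/andP; split; lra.
(* Large [n h]: the terms are bounded separately. The cosine and sine integrals are at most [2 / n]
   each, so the average costs [2 / (n h)] and the radial factor [1 / (n h)]. *)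
- have -> : 3 * `|x| * (n%:R * h)^-1 =
    (2 * h)^-1 * (2 * (2 / n%:R) * `|x|) + (n%:R * h)^-1 * `|x|.
    by field; rewrite !gt_eqF.
  apply: (le_trans (ler_normD _ _)); rewrite normrN; apply: lerD; last first.
    rewrite normrM; apply: ler_pM => //; rewrite ger0_norm//.
    by rewrite -[leRHS]div1r ler_pdivlMr// mulrC onem_expr_le.
  rewrite normrM gtr0_norm ?invr_gt0// ler_pM2l ?invr_gt0//.
  have -> : I = c x * \int[mu]_(s in `]t - h, t + h[) cos (n%:R * s) +
     c (i * x) * \int[mu]_(s in `]t - h, t + h[) sin (n%:R * s).
    rewrite -!RintegralZl//; last 2 first.
    - exact/continuous_integrable_oo/continuous_sinM.
    - exact/continuous_integrable_oo/continuous_cosM.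
    rewrite -RintegralD//; last 2 first.
    - apply: continuous_integrable_oo => s; apply: cvgMl_tmp; exact: continuous_cosM.
    - apply: continuous_integrable_oo => s; apply: cvgMl_tmp; exact: continuous_sinM.
    apply: eq_Rintegral => s _.
    by rewrite expq_mul coordD// !coordZ// mulrC [X in _ + X]mulrC.
  have nn0 : n%:R != 0 :> R by rewrite gt_eqF.
  have i1 := norm_Rintegral_cos ab nn0; have i2 := norm_Rintegral_sin ab nn0.
  rewrite normr_nat in i1 i2.
  apply: (le_trans (ler_normD _ _)); rewrite !normrM.
  have -> : 2 * (2 / n%:R) * `|x| = `|x| * (2 / n%:R) + `|x| * (2 / n%:R) by ring.
  apply: lerD; apply: ler_pM => //; first exact: coord_le.
  by rewrite (le_trans (coord_le cc _))// normq_mul (proj2 is1) mul1r.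
Qed.

Lemma lebesgue_pt_avg (F : R -> R) (t e : R) :
  (forall a b, a < b -> mu.-integrable `]a, b[ (EFin \o F)) ->
  lebesgue_pt F t -> 0 < e ->
  exists2 d : R, 0 < d & forall h, 0 < h < d ->
    `|(2 * h)^-1 * (\int[mu]_(s in `]t - h, t + h[) F s) - F t| <= e.
Proof.
move=> iF Ft e0.
have /fine_cvgP[_ /cvgrPdist_lt/(_ e e0)[d /= d0 hd]] := Ft.
exists d => // h /andP[h0 hlt].
have ab : t - h < t + h by rewrite ltrD2l gtrN.
have h20 : 0 < 2 * h by rewrite mulr_gt0.
have icst : mu.-integrable `]t - h, t + h[ (EFin \o (fun=> F t)).
  by apply: continuous_integrable_oo => u; exact: cvg_cst.
have iB : mu.-integrable `]t - h, t + h[ (EFin \o (fun s => F s - F t)).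
  have hB := fun m =>
    @integrableB _ _ _ mu `]t - h, t + h[%classic m _ _ (iF _ _ ab) icst.
  by apply: hB.
have -> : (2 * h)^-1 * (\int[mu]_(s in `]t - h, t + h[) F s) - F t =
    (2 * h)^-1 * \int[mu]_(s in `]t - h, t + h[) (F s - F t).
  rewrite RintegralB//; last exact: iF.
  rewrite Rintegral_oo_cst ?(ltW ab)//; field; exact: lt0r_neq0.
rewrite normrM gtr0_norm ?invr_gt0//.
apply: (@le_trans _ _ ((2 * h)^-1 * \int[mu]_(s in `]t - h, t + h[) `|F s - F t|)).
  by rewrite ler_wpM2l ?invr_ge0 ?(ltW h20)// le_normr_Rintegral.
have := hd h; rewrite /ball_/= !sub0r !normrN (gtr0_norm h0) => /(_ hlt h0)/ltW.
apply: le_trans; apply: le_trans (ler_norm _).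
rewrite /davg /iavg lebesgue_measure_ball ?(ltW h0)// ball_itv inver mulrn_eq0/=.
rewrite (gt_eqF h0) fineM//=; last first.
  by apply: integrable_fin_num => //; exact: integrable_abse iB.
by rewrite mulr_natl; exact: lexx.
Qed.

End RadialLimit.

Section RadialLimitSeries.
Variable R : realType.
Local Notation H := (quat R).
Local Notation mu := (@lebesgue_measure R).

(** With [h = 1 - r], the average of [F] over []t - h, t + h[] lies between [F t] and [c (phi r)].
    The second comparison is made mode by mode on the partial sums up to [N_ k], uniformly in [k],
    and survives the limit because integrals over intervals converge along [N_]. *)
Lemma radial_limit_lebesgue_pt (i : H) (c : H -> R) (n : nat -> nat) (a : nat -> H)
    (A : R) (N_ : nat -> nat) (F : R -> R) (t : R) (phi : R -> H) :
  imag_sphere i -> coordinate c -> 1 < A -> (forall l, (0 < n l)%N) ->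
  (forall l, A * (n l)%:R <= (n l.+1)%:R) ->
  `|a l| @[l --> \oo] --> (0 : R) -> N_ k @[k --> \oo] --> \oo ->
  (forall x y, x < y -> mu.-integrable `]x, y[ (EFin \o F)) ->
  (forall x y, x < y ->
    \int[mu]_(s in `]x, y[) c (trig i (fun l => (n l)%:R) a 0 (N_ k) s) @[k --> \oo]
    --> \int[mu]_(s in `]x, y[) F s) ->
  (forall r : R, 0 < r < 1 ->
    \sum_(0 <= l < N) r ^+ n l *: (expq i ((n l)%:R * t) * a l)
      @[N --> \oo] --> phi r) ->
  lebesgue_pt F t -> c (phi r) @[r --> (1 : R)^'-] --> F t.
Proof.
move=> is1 cc A1 n0 nA a0 N_oo iF cF phiE Ft.
have nu0 l : 0 < (n l)%:R :> R by rewrite ltr0n.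
apply/cvgrPdist_le => e e0.
have e20 : 0 < e / 2 by rewrite divr_gt0.
have [d1 d10 hd1] := lebesgue_pt_avg iF Ft e20.
have x0 l : 0 <= 3 * `|a l| :> R by rewrite mulr_ge0.
have xc : 3 * `|a l| @[l --> \oo] --> (0 : R).
  by rewrite -[X in _ --> X](mulr0 3); apply: cvgMl_tmp.
have [d2 d20 hd2] := lac_sum_min_cvg0 A1 nu0 nA x0 xc e20.
near=> r.
have rlt : r < 1 by near: r; exact: nbhs_left_lt.
have rgt : 1 - Num.min 1 (Num.min d1 d2) < r.
  by near: r; apply: nbhs_left_gt; rewrite gtrBl !lt_min ltr01 d10 d20.
have : 1 - r < Num.min 1 (Num.min d1 d2) by rewrite ltrBlDr addrC -ltrBlDr.
rewrite !lt_min => /and3P[r1 hlt1 hlt2].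
have h0 : 0 < 1 - r by rewrite subr_gt0.
have r01 : 0 < r < 1 by rewrite rlt andbT; lra.
set h := 1 - r in h0 r1 hlt1 hlt2.
have rE : r = 1 - h by rewrite /h; ring.
set D := (2 * h)^-1 * (\int[mu]_(s in `]t - h, t + h[) F s).
have ab : t - h < t + h by rewrite ltrD2l gtrN.
apply: (@le_trans _ _ (`|F t - D| + `|D - c (phi r)|)).
  by rewrite (le_trans _ (ler_normD _ _))// addrA subrK.
have -> : e = e / 2 + e / 2 by field.
apply: lerD; first by rewrite distrC hd1 ?h0.
pose S k := \sum_(0 <= l < N_ k) r ^+ n l *: (expq i ((n l)%:R * t) * a l).
have cv : (2 * h)^-1 * (\int[mu]_(s in `]t - h, t + h[)
    c (trig i (fun l => (n l)%:R) a 0 (N_ k) s)) - c (S k)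
    @[k --> \oo] --> D - c (phi r).
  apply: cvgB; first by apply: cvgMl_tmp; exact: cF.
  apply: (@coord_cvg _ _ _ _ _ S (phi r) cc).
  exact: (cvg_comp _ _ N_oo (phiE r r01)).
apply: (cvgr_to_le (cvg_norm cv)).
apply: nearW => k.
apply: le_trans (hd2 h (N_ k) _); last by rewrite h0.
have -> : \int[mu]_(s in `]t - h, t + h[) c (trig i (fun l => (n l)%:R) a 0 (N_ k) s) =
   \sum_(0 <= l < N_ k) \int[mu]_(s in `]t - h, t + h[) c (expq i ((n l)%:R * s) * a l).
  rewrite -Rintegral_oo_sum; last by move=> l; exact: continuous_coord_expq.
  by apply: eq_Rintegral => s _; rewrite /trig coord_sum.
rewrite /S coord_sum// mulr_sumr -sumrB (le_trans (ler_norm_sum _ _ _))//.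
apply: ler_sum => l _; rewrite coordZ// rE.
by apply: avg_expq_radial => //; exact: ltW.
Unshelve. all: by end_near. Qed.

End RadialLimitSeries.

(** * Parseval's identity on circles *)

Section HardySpace.
Variable R : realType.
Local Notation H := (quat R).
Local Notation mu := (@lebesgue_measure R).
Implicit Types i : H.
Variables (f : H -> H) (a : nat -> H) (n : nat -> nat).
Hypothesis n_incr : forall l, (n l < n l.+1)%N.
Hypothesis f_series : forall s : H, unit_ball s ->
  \sum_(0 <= l < N) s ^+ n l * a l @[N --> \oo] --> f s.

Lemma unit_ball_expq i (r t : R) : imag_sphere i -> 0 < r < 1 ->
  unit_ball (r *: expq i t).
Proof.
move=> is1 /andP[r0 r1].
by rewrite /unit_ball/= normrZ normq_expq1// mulr1 gtr0_norm.
Qed.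

Lemma series_expq i (r t : R) : imag_sphere i -> 0 < r < 1 ->
  \sum_(0 <= l < N) r ^+ n l *: (expq i ((n l)%:R * t) * a l) @[N --> \oo] -->
  f (r *: expq i t).
Proof.
move=> is1 r01; have := f_series (unit_ball_expq t is1 r01).
by under eq_fun do under eq_bigr do rewrite expq_pow// -scalerAl.
Qed.

Lemma n_inj : injective n.
Proof.
have n_lt l k : (l < k)%N -> (n l < n k)%N.
  elim: k => // k IH; rewrite ltnS leq_eqVlt => /predU1P[->//|/IH].
  by move=> /ltn_trans; apply.
move=> l k E; case: (ltngtP l k) => // /n_lt; rewrite E ltnn//.
Qed.

Lemma n_ge l : (l <= n l)%N.
Proof. by elim: l => // l IH; exact: leq_ltn_trans (n_incr l). Qed.

(** Abel's lemma: convergence at an intermediate radius [s] bounds the terms there, and [n l >= l]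
    then gives a geometric majorant of ratio [r / s]. *)
Lemma series_abs_bounded i (r : R) : imag_sphere i -> 0 < r < 1 ->
  exists B : R, forall N, \sum_(0 <= l < N) r ^+ n l * `|a l| <= B.
Proof.
move=> is1 /andP[r0 r1].
pose s := (1 + r) / 2; have rs : r < s by rewrite /s; lra.
have s1 : s < 1 by rewrite /s; lra.
have s0 : 0 < s by exact: lt_trans rs.
have s01 : 0 < s < 1 by rewrite s0.
have cS := @series_expq i s 0 is1 s01.
have [K K0 hK] : exists2 K : R, 0 <= K & forall l, s ^+ n l * `|a l| <= K.
  have /cvg_seq_bounded[M [_ hM]] : cvgn (fun N =>
      \sum_(0 <= l < N) s ^+ n l *: (expq i ((n l)%:R * 0) * a l)) by exact: cvgP cS.
  have {}hM := hM (M + 1) (ltac:(by rewrite ltrDl)).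
  exists (M + 1 + (M + 1)) => [|l]; first by rewrite addr_ge0// (le_trans _ (hM 0%N I)).
  have -> : s ^+ n l * `|a l| = `|s ^+ n l *: (expq i ((n l)%:R * 0) * a l)| :> R.
    by rewrite normrZ normq_expq// ger0_norm// exprn_ge0// ltW.
  have -> : s ^+ n l *: (expq i ((n l)%:R * 0) * a l) =
     \sum_(0 <= l < l.+1) s ^+ n l *: (expq i ((n l)%:R * 0) * a l) -
     \sum_(0 <= l < l) s ^+ n l *: (expq i ((n l)%:R * 0) * a l).
    by rewrite [in RHS]big_nat_recr//= [RHS]addrC addKr.
  by rewrite (le_trans (ler_normB _ _))// lerD// hM.
pose q := r / s.
have q0 : 0 <= q by rewrite divr_ge0// ltW.
have q1 : q < 1 by rewrite ltr_pdivrMr// mul1r.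
exists (K * (1 - q)^-1) => N.
apply: (@le_trans _ _ (\sum_(0 <= l < N) K * q ^+ l)).
  apply: ler_sum => l _; have -> : r = q * s by rewrite /q divfK// gt_eqF.
  rewrite exprMn -mulrA mulrC; apply: ler_pM => //.
  - by rewrite mulr_ge0// exprn_ge0// ltW.
  - by rewrite exprn_ge0.
  - by rewrite ler_wiXn2l ?n_ge// ltW.
rewrite -mulr_sumr ler_wpM2l//.
rewrite -[leRHS]mul1r ler_pdivlMr ?subr_gt0//.
have -> : (\sum_(0 <= l < N) q ^+ l) * (1 - q) = 1 - q ^+ N.
  elim: N => [|N IH]; first by rewrite big_geq// mul0r expr0 subrr.
  by rewrite big_nat_recr//= mulrDl IH exprS; ring.
by rewrite gerBl exprn_ge0.
Qed.

Lemma Rintegral_cc_oo (g : R -> R) (x y : R) : continuous g ->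
  (\int[mu]_(t in `[x, y]) (g t)%:E = (\int[mu]_(t in `]x, y[) g t)%:E)%E.
Proof.
move=> cg; rewrite /Rintegral fineK; last first.
  exact/integrable_fin_num/continuous_integrable_oo.
rewrite -(@integral_itv_bndoo _ _ _ _ true false)//.
by apply/measurable_EFinP/measurable_funTS; exact: continuous_measurable_fun.
Qed.

(** Parseval is exact for partial sums; the bound [B] of [series_abs_bounded] is uniform on the
    circle, so dominated convergence carries it over to [f]. *)
Lemma square_mean_cvg i (r : R) : imag_sphere i -> 0 < r < 1 ->
  (\sum_(0 <= l < N) (r ^+ n l * `|a l|) ^+ 2)%:E @[N --> \oo] --> square_mean f i r.
Proof.
move=> is1 r01; have [B hB] := series_abs_bounded is1 r01.
have r0 : 0 <= r by case/andP: r01 => /ltW.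
pose T N := trig i (fun l => (n l)%:R) (fun l => r ^+ n l *: a l) 0 N.
have Tf t : T N t @[N --> \oo] --> f (r *: expq i t).
  have := @series_expq i r t is1 r01; rewrite /T /trig.
  by under eq_fun do under eq_bigr do rewrite scalerAr.
have TB N t : `|T N t| <= B.
  apply: le_trans (hB N); rewrite (le_trans (ler_norm_sum _ _ _))//.
  by apply: ler_sum => l _; rewrite normq_expq// normrZ ger0_norm// exprn_ge0.
have cT N : continuous (fun t => `|T N t| ^+ 2 : R).
  by apply: continuous_normq_sqr; exact: continuous_trig.
have mT N : measurable_fun (`[0%R, 2 * pi] : set R) (fun t => (`|T N t| ^+ 2)%:E).
  by apply/measurable_EFinP/measurable_funTS; exact: continuous_measurable_fun.
have Tf2 t : `[0%R, (2 * pi)%R]%classic t ->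
    (`|T N t| ^+ 2)%:E @[N --> \oo] --> (`|f (r *: expq i t)| ^+ 2)%:E.
  move=> _; apply: cvg_EFin_real; rewrite -[(X in _ --> X)]/(_ ^+ 2) expr2.
  under eq_fun do rewrite expr2.
  by apply: cvgM; apply: cvg_norm; exact: Tf.
have [||||_ _ dc] := @dominated_convergence _ _ _ mu `[0%R, (2 * pi)%R]
   (measurable_itv _)
   (fun N t => (`|T N t| ^+ 2)%:E) (fun t => (`|f (r *: expq i t)| ^+ 2)%:E)
   (fun=> (B ^+ 2)%:E) mT.
- exact: (emeasurable_fun_cvg (fun N t => (`|T N t| ^+ 2)%:E) _ mT Tf2).
- exact: aeW.
- apply: continuous_compact_integrable; first exact: segment_compact.
  by apply: continuous_subspaceT => u; exact: cvg_cst.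
- apply: aeW => t N _; rewrite /= lee_fin ger0_norm ?sqr_ge0//.
  by rewrite ler_pXn2r ?nnegrE// (le_trans _ (TB 0%N t)).
rewrite /square_mean.
have pi2 : 0 < 2 * pi :> R by rewrite mulr_gt0 ?pi_gt0.
have E N : (\sum_(0 <= l < N) (r ^+ n l * `|a l|) ^+ 2)%:E =
   (((2 * pi)^-1)%:E * \int[mu]_(t in `[0%R, (2 * pi)%R]) (`|T N t| ^+ 2)%:E)%E.
  rewrite Rintegral_cc_oo// trig_energy_2pi//; last exact: n_inj.
  rewrite -EFinM mulrA mulVf ?gt_eqF// mul1r; congr EFin; apply: eq_bigr => l _.
  by rewrite normrZ ger0_norm// exprn_ge0.
under eq_fun do rewrite E.
by apply: cvgeZl.
Qed.

Lemma square_mean_ge i (r : R) N : imag_sphere i -> 0 < r < 1 ->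
  ((\sum_(0 <= l < N) (r ^+ n l * `|a l|) ^+ 2)%:E <= square_mean f i r)%E.
Proof.
move=> is1 r01; apply: (cvge_to_ge (square_mean_cvg is1 r01)).
near=> M; rewrite lee_fin [leRHS](@big_cat_nat _ _ _ N)//=; last first.
  by near: M; exact: nbhs_infty_ge.
by rewrite lerDl sumr_ge0// => l _; exact: sqr_ge0.
Unshelve. all: by end_near. Qed.

Lemma square_mean_mono i (r s : R) : imag_sphere i -> 0 < r -> r <= s -> s < 1 ->
  (square_mean f i r <= square_mean f i s)%E.
Proof.
move=> is1 r0 rs s1.
have r01 : 0 < r < 1 by rewrite r0 (le_lt_trans rs).
have s01 : 0 < s < 1 by rewrite s1 (lt_le_trans r0).
apply: (cvge_to_le (square_mean_cvg is1 r01)); apply: nearW => N.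
apply: le_trans (square_mean_ge N is1 s01); rewrite lee_fin.
have s0 : 0 < s by exact: lt_le_trans rs.
have p (y : R) l : 0 < y -> 0 <= y ^+ n l * `|a l|.
  by move=> y0; rewrite mulr_ge0// exprn_ge0// ltW.
apply: ler_sum => l _; rewrite ler_pXn2r ?nnegrE ?p//.
by rewrite ler_wpM2r// lerXn2r ?nnegrE ?(ltW r0) ?(ltW s0).
Qed.

Lemma H2_summable i : imag_sphere i ->
  (lim (square_mean f i r @[r --> (1 : R)^'-]) < +oo)%E ->
  exists B : R, forall N, \sum_(0 <= l < N) `|a l| ^+ 2 <= B.
Proof.
move=> is1.
(* The reflection [r := - r] turns the left limit of an increasing function into the right limit of
   a decreasing one, which identifies the [lim] of the hypothesis with a supremum. *)
have c : square_mean f i r @[r --> (1 : R)^'-] -->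
   ereal_sup [set (square_mean f i \o -%R) x | x in `](- 1 : R), 0[%classic].
  apply/cvg_at_leftNP; apply: nonincreasing_at_right_cvge.
    by rewrite bnd_simp ltrN10.
  move=> r s; rewrite !in_itv/= => /andP[r1 r0] /andP[s1 s0] rs.
  by apply: square_mean_mono => //; rewrite ?oppr_gt0 ?lerN2// ltrNl.
set L := ereal_sup _ in c; rewrite (cvg_lim _ c)// => Loo.
have LE (r : R) : 0 < r < 1 -> (square_mean f i r <= L)%E.
  move=> /andP[r0 r1]; apply: ereal_sup_ubound; exists (- r); rewrite /= ?opprK//.
  by rewrite in_itv/= ltrN2 r1 oppr_lt0.
have half : 0 < (2^-1 : R) < 1 by rewrite invr_gt0 invf_lt1// ltr0n ltr1n.
have L0 : (0 <= L)%E.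
  rewrite (le_trans _ (LE _ half))//.
  by rewrite (le_trans _ (square_mean_ge 0 is1 half))// big_geq.
exists (fine L) => N.
(* For fixed [N] the finite sum is continuous in [r], so the bound [L] persists at radius 1. *)
have cE : \sum_(0 <= l < N) (r ^+ n l * `|a l|) ^+ 2 @[r --> (1 : R)^'-] -->
    \sum_(0 <= l < N) ((1 : R) ^+ n l * `|a l|) ^+ 2.
  apply: cvg_at_left_filter; apply: cvg_sumr => l.
  apply: (@continuous_comp _ _ _ (fun r : R => r ^+ n l * `|a l|)
    (fun y : R => y ^+ 2)).
    by apply: cvgMr_tmp; exact: exprn_continuous.
  exact: exprn_continuous.
have -> : \sum_(0 <= l < N) `|a l| ^+ 2 =
    \sum_(0 <= l < N) ((1 : R) ^+ n l * `|a l|) ^+ 2.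
  by apply: eq_bigr => l _; rewrite expr1n mul1r.
apply: (cvgr_to_le cE); near=> r.
have r01 : 0 < r < 1.
  by apply/andP; split; near: r; [exact: nbhs_left_gt|exact: nbhs_left_lt].
rewrite -lee_fin fineK ?ge0_fin_numE//.
exact: le_trans (square_mean_ge N is1 r01) (LE _ r01).
Unshelve. all: by end_near. Qed.

End HardySpace.

(** * Oscillation on intervals *)

Section IntegralAe.
Context d (T : measurableType d) (R : realType).
Variable mu : {measure set T -> \bar R}.
Import HBNNSimple.
Local Open Scope ereal_scope.

(** A simple function below [g1], cut to zero on the null set, keeps its integral and lies below
    [g2], on the null set because [g2] is nonnegative. *)
Let le_sup_sintegral (N : set T) (g1 g2 : T -> \bar R) :
  measurable N -> mu N = 0 -> (forall x, 0 <= g2 x) ->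
  (forall x, ~ N x -> g1 x <= g2 x) ->
  ereal_sup [set sintegral mu h |
    h in [set h : {nnsfun T >-> R} | forall x, (h x)%:E <= g1 x]] <=
  ereal_sup [set sintegral mu h |
    h in [set h : {nnsfun T >-> R} | forall x, (h x)%:E <= g2 x]].
Proof.
move=> mN N0 g20 g12; apply: ge_ereal_sup => _ [h hg1 <-].
have mNC := measurableC mN.
pose h' := proj_nnsfun h mNC.
have h'E : h' =1 h \_ (~` N) by move=> x; rewrite -mrestrict.
apply: le_ereal_sup_tmp; exists (sintegral mu h').
  exists h' => // x; rewrite h'E patchE; case: ifPn => [|_]; last exact: g20.
  by rewrite inE => Nx; exact: le_trans (hg1 x) (g12 x Nx).
have -> : sintegral mu h' = \int[mu]_(x in ~` N) (h x)%:E.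
  by rewrite integral_nnsfun//; apply: eq_sintegral.
rewrite -[X in sintegral mu X](_ : h \_ setT = h); last by rewrite patch_setT.
rewrite -integral_nnsfun// -setTD -ge0_negligible_integral//.
- by apply/measurable_EFinP.
- by move=> x _; rewrite lee_fin; exact: fun_ge0.
Qed.

(* Unlike [ae_eq_integral], no measurability is asked for: radial limits, with
   their junk values, are not known to be Borel. *)
Lemma ae_eq_integral_nomeas (D : set T) (g1 g2 : T -> \bar R) :
  {ae mu, forall x, g1 x = g2 x} ->
  \int[mu]_(x in D) g1 x = \int[mu]_(x in D) g2 x.
Proof.
move=> [N [mN N0 subN]].
have E x : ~ N x -> g1 x = g2 x by move=> Nx; apply: contrapT => /subN.
rewrite /integral; congr (_ - _); apply/eqP; rewrite eq_le; apply/andP; split;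
  apply: (le_sup_sintegral mN N0) => x; rewrite ?(funeposE, funenegE).
all: try by rewrite le_max lexx orbT.
all: by move=> /E g12; rewrite !patchE g12.
Qed.

End IntegralAe.

Section Oscillation.
Variable R : realType.
Local Notation H := (quat R).
Local Notation mu := (@lebesgue_measure R).

(* The default value makes [qcoord k] a coordinate for every [k]. *)
Definition qcoord k : H -> R := nth (@qre R) [:: @qre R; @qi R; @qj R; @qk R] k.

Lemma qcoordP k : coordinate (qcoord k).
Proof.
case: k => [|[|[|[|k]]]]; rewrite /qcoord /= ?nth_nil.
- exact: qre_coordinate.
- exact: qi_coordinate.
- exact: qj_coordinate.
- exact: qk_coordinate.
- exact: qre_coordinate.
Qed.

Lemma normq_sqr_qcoord (z : H) : `|z| ^+ 2 = \sum_(0 <= k < 4) qcoord k z ^+ 2 :> R.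
Proof. by rewrite normq_sqr /dotq !big_nat_recr//= big_geq// add0r. Qed.

Lemma qcoord_integralq k (D : set R) (g : R -> H) :
  qcoord k (integralq D g) = \int[mu]_(t in D) qcoord k (g t).
Proof. by case: k => [|[|[|[|k]]]]; rewrite /qcoord //= nth_nil. Qed.

Lemma cvg_qcoord (T : Type) (F : set_system T) {FF : Filter F} (g : T -> H) (z : H) :
  (forall k, qcoord k (g t) @[t --> F] --> qcoord k z) -> g @ F --> z.
Proof.
by move=> h; apply: cvg_coord;
  [exact: (h 0%N)|exact: (h 1%N)|exact: (h 2%N)|exact: (h 3%N)].
Qed.

(** Around the mean the cross term of the expanded square integrates to zero. *)
Lemma Rintegral_variance_min (v : R -> R) (x y w : R) : x < y -> continuous v ->
  \int[mu]_(t in `]x, y[) (v t - (y - x)^-1 * \int[mu]_(s in `]x, y[) v s) ^+ 2 <=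
  \int[mu]_(t in `]x, y[) (v t - w) ^+ 2.
Proof.
move=> xy cv; set m := _ * Rintegral _ _ _.
have yx0 : 0 < y - x by rewrite subr_gt0.
have cst_cont (z : R) : continuous (fun _ : R => z) by move=> u; exact: cvg_cst.
have cB z : continuous (fun t => v t - z).
  by move=> t; apply: cvgB; [exact: cv|exact: cst_cont].
have csq z : continuous (fun t => (v t - z) ^+ 2).
  move=> t; apply: (@continuous_comp _ _ _ (fun t => v t - z) (fun y : R => y ^+ 2)).
    exact: cB.
  exact: exprn_continuous.
have cl z z' : continuous (fun t => z * (v t - z')).
  by move=> t; apply: cvgMl_tmp; exact: cB.
have -> : \int[mu]_(t in `]x, y[) (v t - w) ^+ 2 =
   \int[mu]_(t in `]x, y[) (v t - m) ^+ 2 +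
   (\int[mu]_(t in `]x, y[) (2 * (m - w) * (v t - m)) +
   \int[mu]_(t in `]x, y[) (m - w) ^+ 2).
  rewrite -RintegralD//; [|exact: continuous_integrable_oo..].
  rewrite -RintegralD//; [|exact: continuous_integrable_oo|].
    by apply: eq_Rintegral => t _; ring.
  apply: continuous_integrable_oo => t; apply: cvgD; first exact: cl.
  exact: cst_cont.
rewrite RintegralZl//; last exact: continuous_integrable_oo.
rewrite RintegralB//; [|exact: continuous_integrable_oo..].
have mE : m * (y - x) = \int[mu]_(s in `]x, y[) v s.
  by rewrite /m mulrAC mulVf ?gt_eqF// mul1r.
rewrite !Rintegral_oo_cst ?(ltW xy)// mE subrr mulr0 add0r.
by rewrite lerDl mulr_ge0 ?sqr_ge0// ltW.
Qed.

(** It permits replacing the mean by a convenient constant: later the value, at the left endpoint,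
    of the modes below the threshold. *)
Lemma normq_variance_min (g : R -> H) (x y : R) (w : H) : x < y -> continuous g ->
  \int[mu]_(t in `]x, y[) `|g t - (y - x)^-1 *: integralq `]x, y[ g| ^+ 2 <=
  \int[mu]_(t in `]x, y[) `|g t - w| ^+ 2.
Proof.
move=> xy cg.
have cq k : continuous (fun t => qcoord k (g t)).
  by move=> t; apply: coord_cvg (cg t); exact: qcoordP.
have E z : \int[mu]_(t in `]x, y[) `|g t - z| ^+ 2 =
    \sum_(0 <= k < 4) \int[mu]_(t in `]x, y[) (qcoord k (g t) - qcoord k z) ^+ 2.
  rewrite -Rintegral_oo_sum => [|k t]; last first.
    apply: (@continuous_comp _ _ _ (fun t => qcoord k (g t) - qcoord k z)
        (fun y : R => y ^+ 2)).
      by apply: cvgB; [exact: cq|exact: cvg_cst].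
    exact: exprn_continuous.
  apply: eq_Rintegral => t _; rewrite normq_sqr_qcoord; apply: eq_bigr => k _.
  by rewrite coordB//; exact: qcoordP.
rewrite !E; apply: ler_sum => k _.
by rewrite coordZ ?qcoord_integralq; [exact: Rintegral_variance_min|exact: qcoordP].
Qed.

Lemma trig_oscillation A (i : H) (nu : nat -> R) (a : nat -> H) m N (x y : R) :
  imag_sphere i -> 1 < A -> (forall l, 0 < nu l) ->
  (forall l, A * nu l <= nu l.+1) ->
  (forall l, (l < m)%N -> nu l * (y - x) < 1) -> 1 <= nu m * (y - x) -> (m <= N)%N ->
  \int[mu]_(t in `]x, y[) `|trig i nu a 0 N t - trig i nu a 0 m x| ^+ 2 <=
  (y - x) * (2 * (\sum_(0 <= l < m) 2 * `|a l| *
     Num.min (nu l * (y - x)) (nu l * (y - x))^-1) ^+ 2 +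
   2 * (8 * lac_const A ^+ 2 + 1) * \sum_(m <= l < N) `|a l| ^+ 2).
Proof.
move=> is1 A1 nu0 nuA mlt mge mN.
have yx0 : 0 < y - x by rewrite -(pmulr_rgt0 _ (nu0 m)) (lt_le_trans ltr01).
have xy : x < y by rewrite -subr_gt0.
set E := \sum_(0 <= l < m) _.
have cT := @continuous_trig R i nu a m N.
have c2 : continuous (fun t => 2 * `|trig i nu a m N t| ^+ 2).
  by move=> t; apply: cvgMl_tmp; exact: continuous_normq_sqr.
have cE : continuous (fun _ : R => 2 * E ^+ 2) by move=> t; exact: cvg_cst.
apply: (@le_trans _ _ (\int[mu]_(t in `]x, y[)
    (2 * E ^+ 2 + 2 * `|trig i nu a m N t| ^+ 2))).
  apply: le_Rintegral => //.
  - apply: continuous_integrable_oo; apply: continuous_normq_sqr => t.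
    by apply: cvgB; [exact: continuous_trig|exact: cvg_cst].
  - by apply: continuous_integrable_oo => t; apply: cvgD; [exact: cE|exact: c2].
  move=> t /=; rewrite in_itv/= => /andP[xt ty].
  (* The increment of the low modes is at most [E] pointwise, the high modes are handled in mean
     square, and [(p + q)^2 <= 2 p^2 + 2 q^2] joins the two. *)
  have -> : trig i nu a 0 N t - trig i nu a 0 m x =
      (trig i nu a 0 m t - trig i nu a 0 m x) + trig i nu a m N t.
    by rewrite [trig i nu a 0 N t](@big_cat_nat _ _ _ m)//= addrAC.
  have low : `|trig i nu a 0 m t - trig i nu a 0 m x| <= E.
    rewrite /trig -sumrB (le_trans (ler_norm_sum _ _ _))//.
    apply: ler_sum_nat => l /andP[_ lm].
    apply: (le_trans (expq_lip _ _ _ is1)).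
    rewrite -mulrA (mulrC _ `|a l|) mulrA ler_wpM2l ?mulr_ge0// -mulrBr.
    have nuyx : 0 < nu l * (y - x) by rewrite mulr_gt0.
    rewrite normrM gtr0_norm// gtr0_norm ?subr_gt0//.
    rewrite (@le_trans _ _ (nu l * (y - x)))//.
      by rewrite ler_wpM2l ?(ltW (nu0 l))// lerD2r ltW.
    (* Below the threshold [nu l * (y - x) < 1], so the minimum is its first argument. *)
    rewrite le_min lexx/= -[leRHS]div1r ler_pdivlMr//.
    by have := ltW (mlt l lm); move: (nu l * (y - x)) nuyx => z z0 z1; nra.
  apply: (@le_trans _ _
    ((`|trig i nu a 0 m t - trig i nu a 0 m x| + `|trig i nu a m N t|) ^+ 2)).
    by rewrite ler_pXn2r ?nnegrE ?addr_ge0// ler_normD.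
  move: low; have := normr_ge0 (trig i nu a 0 m t - trig i nu a 0 m x).
  move: `|trig i nu a 0 m t - trig i nu a 0 m x| `|trig i nu a m N t| => p q p0 pE.
  have : p ^+ 2 <= E ^+ 2 by rewrite ler_pXn2r ?nnegrE// (le_trans p0).
  by have := sqr_ge0 (p - q); nra.
rewrite RintegralD//; [|exact: continuous_integrable_oo..].
rewrite Rintegral_oo_cst ?(ltW xy)// [leRHS]mulrDr (mulrC _ (y - x)) lerD2l.
rewrite RintegralZl//; last first.
  by apply: continuous_integrable_oo; exact: continuous_normq_sqr.
have := @trig_energy_le R A i nu a m N x y is1 A1 nu0 nuA mge.
move=> /(ler_wpM2l (ler0n R 2)) /le_trans; apply.
by rewrite le_eqVlt; apply/orP; left; apply/eqP; ring.
Qed.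

Lemma bounded_sum_tail (x : nat -> R) (B : R) : (forall l, 0 <= x l) ->
  (forall N, \sum_(0 <= l < N) x l <= B) ->
  forall e : R, 0 < e -> exists m, forall m' N, (m <= m')%N ->
    \sum_(m' <= l < N) x l <= e.
Proof.
move=> x0 xB e e0; pose s := series x.
have s_nd : nondecreasing_seq s by apply: nondecreasing_series => l _ _; exact: x0.
have s_ub : has_ubound (range s) by exists B => _ [N _ <-]; exact: xB.
have /cvgrPdist_le/(_ e e0)[m _ hm] := nondecreasing_cvgn s_nd s_ub.
exists m => m' N mm'; have [Nm'|m'N] := leqP N m'; first by rewrite big_geq// ltW.
have := hm m' mm'; rewrite /= ler_norml => /andP[_]; apply: le_trans.
have -> : \sum_(m' <= l < N) x l = s N - s m'.
  rewrite /s /series/= [in RHS](@big_cat_nat _ _ _ m' 0 N)//= ?(ltnW m'N)//.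
  by rewrite addrAC subrr add0r.
by rewrite lerD2r ub_le_sup//; exists N.
Qed.

Lemma fast_tail (x : nat -> R) (B : R) : (forall l, 0 <= x l) ->
  (forall N, \sum_(0 <= l < N) x l <= B) ->
  exists N_ : nat -> nat, [/\ N_ k @[k --> \oo] --> \oo,
    forall k, (N_ k <= N_ k.+1)%N &
    forall k M, \sum_(N_ k <= l < M) x l <= 4^-1 ^+ k].
Proof.
move=> x0 xB.
have /choice[m_ hm] : forall k, exists m, forall m' N, (m <= m')%N ->
    \sum_(m' <= l < N) x l <= 4^-1 ^+ k.
  by move=> k; apply: bounded_sum_tail xB _ _ => //; rewrite exprn_gt0// invr_gt0.
(* The summand [k] forces divergence; the sum makes [N_] monotone and at least [m_ k]. *)
pose N_ k := (k + \sum_(0 <= j < k.+1) m_ j)%N.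
exists N_; split => [|k|k M].
- apply/cvgnyPge => K; near=> k; rewrite (@leq_trans k)//; last exact: leq_addr.
  by near: k; exact: nbhs_infty_ge.
- by rewrite /N_ [in leqRHS]big_nat_recr//= leq_add ?leqnSn ?leq_addr.
- by apply: hm; rewrite /N_ big_nat_recr//= addnA leq_addl.
Unshelve. all: by end_near. Qed.

End Oscillation.

(** * Lacunary series with square-summable coefficients *)

Section LacunarySeries.
Variable R : realType.
Local Notation H := (quat R).
Local Notation mu := (@lebesgue_measure R).
Variables (f : H -> H) (a : nat -> H) (n : nat -> nat) (A B : R).
Hypothesis A_gt1 : 1 < A.
Hypothesis n_gt0 : forall l, (0 < n l)%N.
Hypothesis n_lac : forall l, A * (n l)%:R <= (n l.+1)%:R.
Hypothesis f_series : forall s : H, unit_ball s ->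
  \sum_(0 <= l < N) s ^+ n l * a l @[N --> \oo] --> f s.
Hypothesis a_sum : forall N, \sum_(0 <= l < N) `|a l| ^+ 2 <= B.

Local Notation nu := (fun l => (n l)%:R : R).

Let nu_gt0 l : 0 < nu l. Proof. by rewrite ltr0n. Qed.

Let a2_ge0 l : 0 <= `|a l| ^+ 2 :> R. Proof. exact: sqr_ge0. Qed.

Let energy_const := 8 * lac_const A ^+ 2 + 1.

Let energy_const_gt0 : 0 < energy_const.
Proof. by rewrite ltr_wpDl// mulr_ge0 ?sqr_ge0. Qed.

Lemma lac_coeff_cvg0 : `|a l| @[l --> \oo] --> (0 : R).
Proof.
apply/cvgrPdist_le => e e0.
have [m hm] := bounded_sum_tail a2_ge0 a_sum (exprn_gt0 2 e0).
near=> l; rewrite sub0r normrN normr_id.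
have ml : (m <= l)%N by near: l; exact: nbhs_infty_ge.
have := hm l l.+1 ml; rewrite big_nat1 ler_pXn2r// ?nnegrE//; exact: ltW.
Unshelve. all: by end_near. Qed.

Section Direction.
Variables (i : H) (N_ : nat -> nat).
Hypothesis is1 : imag_sphere i.
Hypothesis N_oo : N_ k @[k --> \oo] --> \oo.
Hypothesis N_mono : forall k, (N_ k <= N_ k.+1)%N.
Hypothesis N_tail : forall k M, \sum_(N_ k <= l < M) `|a l| ^+ 2 <= 4^-1 ^+ k.

Let S j := trig i nu a 0 (N_ j).

Let S_cont j : continuous (S j). Proof. exact: continuous_trig. Qed.

Let u k j t := qcoord k (S j t).

Let u_cont k j : continuous (u k j).
Proof. by move=> t; apply: coord_cvg (@S_cont j t); exact: qcoordP. Qed.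

Let u_cauchy k x y : x < y -> exists K, forall j,
  \int[mu]_(t in `]x, y[) (u k j.+1 t - u k j t) ^+ 2 <= K * 4^-1 ^+ j.
Proof.
(* [trig_energy_le] asks for an interval of length at least [1 / nu (N_ j)]; lengthening it by
   [1 / nu 0] ensures this for every [j] and keeps the constant independent of [j]. *)
move=> xy; pose y' := y + (nu 0)^-1; exists (energy_const * (y' - x)) => j.
have yy' : y <= y' by rewrite lerDl invr_ge0 ltW.
pose T := trig i nu a (N_ j) (N_ j.+1).
have cT : continuous (fun t => `|T t| ^+ 2 : R).
  by apply: continuous_normq_sqr; exact: continuous_trig.
apply: (@le_trans _ _ (\int[mu]_(t in `]x, y[) `|T t| ^+ 2)).
  apply: le_Rintegral => //.
  - apply: continuous_integrable_oo => t.
    apply: (@continuous_comp _ _ _ (fun t => u k j.+1 t - u k j t)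
      (fun y : R => y ^+ 2)).
      by apply: cvgB; exact: u_cont.
    exact: exprn_continuous.
  - exact: continuous_integrable_oo.
  - move=> t _; rewrite -real_normK ?num_real// ler_pXn2r ?nnegrE//.
    rewrite /u -coordB; last exact: qcoordP.
    have -> : S j.+1 t - S j t = T t.
      by rewrite /S /T /trig (@big_cat_nat _ _ _ (N_ j) 0)//= addrAC subrr add0r.
    exact: (coord_le (qcoordP R k) (T t)).
apply: (@le_trans _ _ (\int[mu]_(t in `]x, y'[) `|T t| ^+ 2)).
  rewrite /Rintegral; apply: fine_le.
  - exact/integrable_fin_num/continuous_integrable_oo.
  - exact/integrable_fin_num/continuous_integrable_oo.
  - apply: ge0_subset_integral => //.
    + by apply/measurable_EFinP/measurable_funTS; exact: continuous_measurable_fun.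
    + by apply: subset_itvl; rewrite bnd_simp.
have h := @trig_energy_le R A i nu a (N_ j) (N_ j.+1) x y' is1 A_gt1 nu_gt0 n_lac.
apply: (le_trans (h _)).
  apply: (@le_trans _ _ (nu 0 * (nu 0)^-1)); first by rewrite mulfV// gt_eqF.
  apply: ler_pM => //; first exact: (lac_incr A_gt1 nu_gt0 n_lac).
  by rewrite /y' -addrA addrCA lerDl subr_ge0 ltW.
rewrite ler_wpM2l// mulr_ge0 ?(ltW energy_const_gt0)// subr_ge0.
exact: le_trans (ltW xy) yy'.
Qed.

Let F k := L1_lim (u k).

Let F_integrable k x y : x < y -> mu.-integrable `]x, y[ (EFin \o F k).
Proof. exact: (L1_lim_integrable (@u_cont k) (@u_cauchy k)). Qed.

Let F_locally_integrable k : locally_integrable setT (F k).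
Proof.
split; [exact: measurable_L1_lim|exact: openT|move=> K _ cK].
have [M [_ hM]] := compact_bounded cK.
pose M' := `|M| + 1.
have M'0 : 0 < M' by rewrite ltr_wpDl.
have MM' : M < M' by rewrite (le_lt_trans (ler_norm _))// ltrDl.
have KM : K `<=` `](- (M' + 1)), (M' + 1)[.
  move=> t /(hM _ MM') tM; rewrite /= in_itv/= -ltr_norml.
  by rewrite (le_lt_trans tM)// ltrDl.
have lt : - (M' + 1) < M' + 1 by rewrite gtrN// addr_gt0.
have /integrableP[mF] := F_integrable k lt.
apply: le_lt_trans; apply: ge0_subset_integral => //.
- exact: compact_measurable.
- apply/measurable_EFinP; apply: measurableT_comp => //.
  exact/measurable_EFinP.
Qed.

Definition lac_boundary t := Quat (F 0 t) (F 1 t) (F 2 t) (F 3 t).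

Let qcoord_boundary k t : qcoord k (lac_boundary t) = F k t.
Proof.
case: k => [|[|[|[|k]]]]//; rewrite /qcoord/= nth_nil /F.
by congr L1_lim; apply/funext => j; apply/funext => s; rewrite /u /qcoord /= nth_nil.
Qed.

Lemma lac_partial_sum_cvg_ae : {ae mu, forall t, S j t @[j --> \oo] --> lac_boundary t}.
Proof.
have := ae_foralln (fun k => L1_lim_cvg (@u_cont k) (@u_cauchy k)).
apply: ae_mono => t h; apply: cvg_qcoord => k; rewrite qcoord_boundary.
exact: h.
Qed.

Lemma lac_boundary_ae : {ae mu, forall t, boundary_value f i t = lac_boundary t}.
Proof.
have := ae_foralln (fun k => lebesgue_differentiation (@F_locally_integrable k)).
apply: ae_mono => t h; apply: cvg_lim => //; apply: cvg_qcoord => k.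
rewrite qcoord_boundary.
apply: (radial_limit_lebesgue_pt is1 (qcoordP R k) A_gt1 n_gt0 n_lac lac_coeff_cvg0 N_oo
  (@F_integrable k) _ _ (h k)).
- exact: (L1_lim_Rintegral (@u_cont k) (@u_cauchy k)).
- by move=> r r01; exact: series_expq.
Qed.

Let mean x y : H := (y - x)^-1 *: integralq `]x, y[ lac_boundary.

Lemma boundary_mean_lac x y : boundary_mean f i x y = mean x y.
Proof.
rewrite /boundary_mean /mean; congr (_ *: _); congr Quat; congr fine;
  apply: ae_eq_integral_nomeas; apply: ae_mono lac_boundary_ae => t ->//.
Qed.

Lemma partial_mean_cvg x y : x < y ->
  (y - x)^-1 *: integralq `]x, y[ (S j) @[j --> \oo] --> mean x y.
Proof.
move=> xy; apply: cvgZl_tmp; apply: cvg_qcoord => k.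
rewrite qcoord_integralq; under eq_fun do rewrite qcoord_integralq.
under eq_Rintegral do rewrite qcoord_boundary.
exact: (L1_lim_Rintegral (@u_cont k) (@u_cauchy k)).
Qed.

(* Fatou is applied to the oscillations of the partial sums around their own
   means, so that only integrals of trigonometric polynomials get estimated. *)
Lemma lac_oscillation_le x y m (T : R) :
  (forall l, (l < m)%N -> nu l * (y - x) < 1) -> 1 <= nu m * (y - x) ->
  (forall M, \sum_(m <= l < M) `|a l| ^+ 2 <= T) ->
  (mean_oscillation f i x y <=
   (2 * (\sum_(0 <= l < m) 2 * `|a l| *
       Num.min (nu l * (y - x)) (nu l * (y - x))^-1) ^+ 2 +
     2 * energy_const * T)%:E)%E.
Proof.
move=> mlt mge mT.
have yx0 : 0 < y - x by rewrite -(pmulr_rgt0 _ (nu_gt0 m)) (lt_le_trans ltr01).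
have xy : x < y by rewrite -subr_gt0.
set E := \sum_(0 <= l < m) _; set bnd := 2 * E ^+ 2 + _.
pose v j t := `|S j t - (y - x)^-1 *: integralq `]x, y[ (S j)| ^+ 2 : R.
have cv j : continuous (v j).
  by apply: continuous_normq_sqr => t; apply: cvgB; [exact: S_cont|exact: cvg_cst].
have mv j : measurable_fun (`]x, y[ : set R) (EFin \o v j).
  by apply/measurable_EFinP/measurable_funTS; exact: continuous_measurable_fun.
rewrite /mean_oscillation lee_pdivrMl// boundary_mean_lac -EFinM.
(* Almost everywhere both [S j t] and the means of [S j] converge, so the integrand is the limit,
   hence the lower limit, of [v j t]. *)
have -> : (\int[mu]_(t in `]x, y[) (`|boundary_value f i t - mean x y| ^+ 2)%:E =
    \int[mu]_(t in `]x, y[) limn_einf (fun j => (v j t)%:E))%E.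
  apply: ae_eq_integral_nomeas.
  apply: (ae_mono2 _ lac_boundary_ae lac_partial_sum_cvg_ae) => t -> St.
  have vt : (v j t)%:E @[j --> \oo] --> (`|lac_boundary t - mean x y| ^+ 2)%:E.
    apply: cvg_EFin_real.
    apply: (@cvg_comp _ _ _
      (fun j => `|S j t - (y - x)^-1 *: integralq `]x, y[ (S j)| : R)
      (fun z => z ^+ 2)); last exact: exprn_continuous.
    by apply: cvg_norm; apply: cvgB => //; exact: partial_mean_cvg.
  by have [-> _] := cvg_limn_einf_sup vt.
have v0 j t : `]x, y[%classic t -> (0 <= (EFin \o v j) t)%E.
  by move=> _; rewrite lee_fin sqr_ge0.
apply: le_trans (fatou mu (measurable_itv _) mv v0) _.
have [j0 _ hj0] := (cvgnyPge N_).1 N_oo m.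
rewrite limn_einf_lim; apply: lime_le; first exact: is_cvg_einfs.
apply: nearW => j.
(* The infimum over the indices from [j] on is tested at [j1], where the partial sum already reaches
   the threshold [m]. *)
pose j1 := maxn j j0.
apply: (@le_trans _ _ (\int[mu]_(t in `]x, y[) (v j1 t)%:E)%E).
  by apply: ereal_inf_lbound; exists j1 => //=; exact: leq_maxl.
rewrite -[leLHS]fineK; last exact/integrable_fin_num/continuous_integrable_oo.
rewrite lee_fin -/(Rintegral _ _ _).
apply: le_trans (normq_variance_min (trig i nu a 0 m x) xy (@S_cont j1)) _.
have mN : (m <= N_ j1)%N by apply: hj0; exact: leq_maxr.
apply: le_trans (trig_oscillation _ is1 A_gt1 nu_gt0 n_lac mlt mge mN) _.
rewrite ler_wpM2l ?(ltW yx0)// lerD2l ler_wpM2l//.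
by rewrite mulr_ge0// ltW.
Qed.

End Direction.

(** Each coefficient has norm at most [B + 1] since its square is at most [B]; the sum of minima is
    at most [2 * lac_const A], and every tail is at most [B]. *)
Let bmo_bound := 2 * (2 * (B + 1) * (2 * lac_const A)) ^+ 2 + 2 * energy_const * B.

Lemma lac_mean_oscillation_bounded i x y : imag_sphere i -> x < y ->
  (mean_oscillation f i x y <= bmo_bound%:E)%E.
Proof.
move=> is1 xy; have [N_ [N_oo N_mono N_tail]] := fast_tail a2_ge0 a_sum.
have yx0 : 0 < y - x by rewrite subr_gt0.
have [m [mlt mge]] := lac_threshold A_gt1 nu_gt0 n_lac yx0.
have tail M : \sum_(m <= l < M) `|a l| ^+ 2 <= B.
  have [Mm|mM] := leqP M m.
    by rewrite big_geq// (le_trans _ (a_sum 0))// big_geq.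
  apply: le_trans (a_sum M); rewrite [leRHS](@big_cat_nat _ _ _ m 0 M)//= ?(ltnW mM)//.
  by rewrite lerDr sumr_ge0.
apply: (le_trans (lac_oscillation_le is1 N_oo N_mono N_tail mlt mge tail)).
rewrite lee_fin lerD2r ler_wpM2l//.
have min0 l : 0 <= Num.min (nu l * (y - x)) (nu l * (y - x))^-1.
  by rewrite le_min invr_ge0 andbb mulr_ge0// ltW.
rewrite ler_pXn2r ?nnegrE.
- apply: (@le_trans _ _ (\sum_(0 <= l < m) 2 * (B + 1) *
      Num.min (nu l * (y - x)) (nu l * (y - x))^-1)).
    apply: ler_sum => l _; rewrite ler_wpM2r// ler_wpM2l//.
    have : `|a l| ^+ 2 <= B.
      by apply: le_trans (a_sum l.+1); rewrite big_nat_recr//= lerDr sumr_ge0.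
    by have := sqr_ge0 (`|a l| - 1); nra.
  rewrite -mulr_sumr ler_wpM2l//; last exact: lac_sum_min.
  by rewrite mulr_ge0// addr_ge0// (le_trans _ (a_sum 0))// big_geq.
- by [].
- by rewrite sumr_ge0// => l _; rewrite !mulr_ge0.
- apply: mulr_ge0; last by apply: mulr_ge0 => //; exact: ltW (lac_const_gt0 A_gt1).
  by rewrite mulr_ge0// addr_ge0// (le_trans _ (a_sum 0))// big_geq.
Qed.

Lemma lac_mean_oscillation_small i (e : R) : imag_sphere i -> 0 < e ->
  exists2 d : R, 0 < d & forall x y, 0 < y - x < d ->
    (mean_oscillation f i x y <= e%:E)%E.
Proof.
move=> is1 e0; have [N_ [N_oo N_mono N_tail]] := fast_tail a2_ge0 a_sum.
(* As [e1 <= 1], a low part [E <= e1] has [2 * E ^+ 2 <= 2 * e1 <= e / 2]; the tail takes the other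
   half of [e]. *)
pose e1 := Num.min 1 (e / 4).
have e10 : 0 < e1 by rewrite lt_min ltr01 divr_gt0.
have e2 : 0 < e / 4 / energy_const by rewrite !divr_gt0.
have [m0 hm0] := bounded_sum_tail a2_ge0 a_sum e2.
have x0 l : 0 <= 2 * `|a l| :> R by rewrite mulr_ge0.
have xc : 2 * `|a l| @[l --> \oo] --> (0 : R).
  by rewrite -[X in _ --> X](mulr0 2); apply: cvgMl_tmp; exact: lac_coeff_cvg0.
have [d1 d10 hd1] := lac_sum_min_cvg0 A_gt1 nu_gt0 n_lac x0 xc e10.
(* A length below [1 / nu m0] forces the threshold to be at least [m0], where the tails are
   small. *)
exists (Num.min d1 (nu m0)^-1); first by rewrite lt_min d10 invr_gt0 nu_gt0.
move=> x y /andP[yx0]; rewrite lt_min => /andP[yd1 yd2].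
have [m [mlt mge]] := lac_threshold A_gt1 nu_gt0 n_lac yx0.
have m0m : (m0 <= m)%N.
  rewrite leqNgt; apply/negP => mm0; move: mge; apply/negP; rewrite -ltNge.
  apply: (@le_lt_trans _ _ (nu m0 * (y - x))).
    by rewrite ler_wpM2r ?(ltW yx0)//; exact: (lac_incr A_gt1 nu_gt0 n_lac (ltnW mm0)).
  by rewrite -ltr_pdivlMl// mulr1.
apply: (le_trans (lac_oscillation_le is1 N_oo N_mono N_tail mlt mge
  (fun M => hm0 m M m0m))).
rewrite lee_fin.
have := hd1 (y - x) m; rewrite yx0 yd1 => /(_ isT).
have : 0 <= \sum_(0 <= l < m) 2 * `|a l| * Num.min (nu l * (y - x)) (nu l * (y - x))^-1.
  rewrite sumr_ge0// => l _; rewrite mulr_ge0// le_min invr_ge0 andbb.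
  by rewrite mulr_ge0// ltW.
have -> : 2 * energy_const * (e / 4 / energy_const) = e / 2.
  by field; exact: lt0r_neq0.
move: (\sum_(0 <= l < m) _) => E E0 Ee1.
have e11 : e1 <= 1 by rewrite ge_min lexx.
have e1e : e1 <= e / 4 by rewrite ge_min lexx orbT.
nra.
Qed.

End LacunarySeries.

Theorem lemma5p8 (R : realType) (f : quat R -> quat R)
    (a : nat -> quat R) (n : nat -> nat) (alpha : R)
    (f_SH : slice_hyperholomorphic f)
    (n_gt0 : forall l : nat, (1 <= l)%N -> (0 < n l)%N)
    (alpha_gt1 : 1 < alpha)
    (n_lacunary : forall l : nat, (1 <= l)%N ->
       alpha <= (n l.+1)%:R / (n l)%:R)
    (f_series : forall s : quat R, unit_ball s ->
       \sum_(1 <= l < N.+1) s ^+ n l * a l @[N --> \oo] --> f s) :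
  (BMOSH f <-> VMOSH f) /\ (VMOSH f <-> H2 f).
Proof.
suff H2V : H2 f -> VMOSH f.
  have BH : BMOSH f -> H2 f by case.
  have VB : VMOSH f -> BMOSH f by case.
  by split; split; auto.
move=> f2; have [_ fsup] := f2.
(* The series starts at index 1, the lemmas on lacunary series at 0. *)
pose n' l := n l.+1; pose a' l := a l.+1.
have n'0 l : (0 < n' l)%N by exact: n_gt0.
have n'lac l : alpha * (n' l)%:R <= (n' l.+1)%:R.
  by rewrite -ler_pdivlMr ?ltr0n//; exact: n_lacunary.
have n'incr l : (n' l < n' l.+1)%N.
  rewrite -(ltr_nat R) (lt_le_trans _ (n'lac l))//.
  by rewrite ltr_pMl// ltr0n.
have f_series' s : unit_ball s ->
    \sum_(0 <= l < N) s ^+ n' l * a' l @[N --> \oo] --> f s.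
  by move=> /f_series; under eq_fun do rewrite big_add1 /=.
(* One slice suffices for summability, as the coefficients are the same on all of them. *)
have is0 : imag_sphere (Quat 0 1 0 0 : quat R).
  split => //; apply/eqP; rewrite -(eqrXn2 (n := 2))// normq_sqr /dotq/=.
  by rewrite !mul0r mulr1 !addr0 add0r expr1n.
have [B aB] : exists B : R, forall N, \sum_(0 <= l < N) `|a' l| ^+ 2 <= B.
  apply: (H2_summable n'incr f_series' is0); apply: le_lt_trans fsup.
  by apply: ereal_sup_ubound; exists (Quat 0 1 0 0).
have osc0 i x y : x < y -> (0 <= mean_oscillation f i x y)%E.
  move=> xy; rewrite /mean_oscillation mule_ge0//.
    by rewrite lee_fin invr_ge0 subr_ge0 ltW.
  by apply: integral_ge0 => t _; rewrite lee_fin sqr_ge0.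
split; first (split=> //).
  pose K := 2 * (2 * (B + 1) * (2 * lac_const alpha)) ^+ 2 +
    2 * (8 * lac_const alpha ^+ 2 + 1) * B.
  apply: (@le_lt_trans _ _ K%:E); last exact: ltry.
  apply: ge_ereal_sup => _ [i [x [y [is1 xy _ ->]]]].
  exact: (lac_mean_oscillation_bounded alpha_gt1 n'0 n'lac f_series' aB is1 xy).
move=> i is1.
have supP (e t : R) : 0 < t -> (forall x, (mean_oscillation f i x (x + t) <= e%:E)%E) ->
    (0 <= ereal_sup [set mean_oscillation f i x (x + t) | x in [set: R]] <= e%:E)%E.
  move=> t0 h; apply/andP; split.
    apply: le_trans (osc0 i 0 (0 + t) _) _; first by rewrite add0r.
    by apply: ereal_sup_ubound; exists 0.
  by apply: ge_ereal_sup => _ [x _ <-].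
have small (e : R) : 0 < e -> \forall t \near (0 : R)^'+,
    (0 <= ereal_sup [set mean_oscillation f i x (x + t) | x in [set: R]] <= e%:E)%E.
  move=> e0; have [d d0 hd] :=
    lac_mean_oscillation_small alpha_gt1 n'0 n'lac f_series' aB is1 e0.
  near=> t; have t0 : 0 < t by near: t; exact: nbhs_right_gt.
  apply: supP => // x; apply: hd; rewrite addrAC subrr add0r t0.
  by near: t; exact: nbhs_right_lt.
apply/fine_cvgP; split.
  apply: filterS (small 1 ltr01) => t /andP[s0 s1].
  by rewrite ge0_fin_numE// (le_lt_trans s1)// ltry.
apply/cvgrPdist_le => e e0; apply: filterS (small e e0) => t /andP[s0 s1].
rewrite sub0r normrN /= ger0_norm ?fine_ge0//.
by rewrite -lee_fin fineK// ge0_fin_numE// (le_lt_trans s1)// ltry.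
Unshelve. all: by end_near. Qed.
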